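(* Any precartesian equipment has lax finite products, and any cartesian equipment has iso-strong finite products.
   Context: Double categories and double functors are pseudo unless otherwise stated. A proarrow is written $m\colon x\nrightarrow y$; a cell $\alpha\colon m\to n$ over $(f,g)$ has left side $f$ and right side $g$. For a span of sets $I\xleftarrow{\ell}A\xrightarrow{r}J$, written $A\colon I\nrightarrow J$, the notation $a\colon i\nrightarrow j$ means $a\in A$, $\ell(a)=i$, $r(a)=j$. ''Lax right adjoint'' means a right adjoint in the 2-category of double categories, lax double functors, and natural transformations. An equipment is a double category in which for every proarrow $n\colon w\nrightarrow z$ and arrows $f\colon x\to w$, $g\colon y\to z$ there is a restriction: a proarrow $p\colon x\nrightarrow y$ and a cell $\mathrm{res}\colon p\to n$ over $(f,g)$ such that every cell $m\to n$ over $(f\circ h,g\circ k)$ factors uniquely as $\mathrm{res}\circ\alpha$ with $\alpha\colon m\to p$ over $(h,k)$. A double category $\mathbb{D}$ is precartesian if it has lax finite parallel products: for every finite set $I$, the diagonal $\Delta_I\colon\mathbb{D}\to\mathbb{D}^I$ has a lax right adjoint (equivalently, $\mathbb{D}\to\mathbb{D}\times\mathbb{D}$ and $\mathbb{D}\to\mathbb{1}$ have lax right adjoints). It is cartesian if these right adjoints are pseudo. A (pre)cartesian equipment is an equipment that is a (pre)cartesian double category. The contravariant double category of finite families $\mathbb{F}\mathsf{inFam}^*(\mathbb{D})$ has: - objects $(I,\underline{x})$: a finite set $I$ and objects $x_i$ of $\mathbb{D}$, $i\in I$; - arrows $(f_0,f)\colon(I,\underline{x})\to(J,\underline{y})$: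 a function $f_0\colon J\to I$ and arrows $f_j\colon x_{f_0(j)}\to y_j$, $j\in J$; - proarrows $(A,\underline{m})\colon(I,\underline{x})\nrightarrow(J,\underline{y})$: a span of finite sets $A\colon I\nrightarrow J$ and proarrows $m_a\colon x_i\nrightarrow y_j$ for each $a\colon i\nrightarrow j$; - cells from $(A,\underline{m})\colon(I,\underline{x})\nrightarrow(J,\underline{y})$ to $(B,\underline{n})\colon(K,\underline{w})\nrightarrow(L,\underline{z})$ over $((f_0,f),(g_0,g))$: a map of spans $(f_0,\alpha_0,g_0)$ from $B$ to $A$ and cells $\alpha_b\colon m_{\alpha_0(b)}\to n_b$ over $(f_k,g_l)$ for each $b\colon k\nrightarrow l$. External composition is by pullback of indexing spans and $(\underline{m}\odot\underline{n})_{(a,b)}=m_a\odot n_b$; the external identity $\mathrm{id}_{\underline x}$ on $(I,\underline{x})$ is the identity span on $I$ with the proarrows $\mathrm{id}_{x_i}$. $\mathbb{D}$ has lax finite products if $\Delta\colon\mathbb{D}\to\mathbb{F}\mathsf{inFam}^*(\mathbb{D})$, sending objects and proarrows to singleton families, has a lax right adjoint $\Pi$, with laxators $\Pi_{\underline{m},\underline{n}}\colon\Pi\underline{m}\odot\Pi\underline{n}\to\Pi(\underline{m}\odot\underline{n})$ and unitors $\Pi_{\underline{x}}\colon\mathrm{id}_{\Pi\underline{x}}\to\Pi(\mathrm{id}_{\underline{x}})$. The finite products are iso-strong if every $\Pi_{\underline{x}}$ is an isomorphism and $\Pi_{\underline{m},\underline{n}}$ is an isomorphism for all composable finite families $(A,\underline{m})\colon(I,\underline{x})\nrightarrow(J,\underline{y})$,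 $(B,\underline{n})\colon(J,\underline{y})\nrightarrow(K,\underline{z})$ such that the legs $A\to J$ and $B\to J$ are bijections. *)

(* Defs.v *)
From HB Require Import structures.
From mathcomp Require Import all_boot.
From Stdlib Require Import FunctionalExtensionality ProofIrrelevance.

Set Implicit Arguments.
Unset Strict Implicit.
Unset Printing Implicit Defensive.

(** Vertical composition of cells is strictly associative and unital, but the
    two sides of such a law lie over the arrows [h ∘ (g ∘ f)] and
    [(h ∘ g) ∘ f], which are equal without being convertible.  [u ≡ v] says
    that the indices of [u] and [v] are equal and that so are [u] and [v]. *)

Inductive eq_over (A B : Type) (T : A -> B -> Type) (f : A) (g : B)
    (u : T f g) : forall (f' : A) (g' : B), T f' g' -> Prop :=
  eq_over_refl : eq_over u u.

Notation "u ≡ v" := (eq_over u v) (at level 70, no associativity).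

(** Arrows compose strictly.  [cell m n f g] is the type of cells [m -> n] with
    left side [f] and right side [g].  External composition [⊙] is written in
    diagrammatic order, composition [∘], [∙] of arrows and cells in applicative
    order. *)

Record dbl_data := DblData {
  ob :> Type;
  arr : ob -> ob -> Type;
  pro : ob -> ob -> Type;
  cell : forall {x y w z : ob},
    pro x y -> pro w z -> arr x w -> arr y z -> Type;
  ida : forall x : ob, arr x x;
  compa : forall {x y z : ob}, arr y z -> arr x y -> arr x z;
  idc : forall {x y : ob} (m : pro x y), cell m m (ida x) (ida y);
  compc : forall {x y x' y' x'' y'' : ob}
    {m : pro x y} {m' : pro x' y'} {m'' : pro x'' y''}
    {f : arr x x'} {g : arr y y'} {f' : arr x' x''} {g' : arr y' y''},
    cell m' m'' f' g' -> cell m m' f g -> cell m m'' (compa f' f) (compa g' g);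
  idp : forall x : ob, pro x x;
  compp : forall {x y z : ob}, pro x y -> pro y z -> pro x z;
  idpc : forall {x y : ob} (f : arr x y), cell (idp x) (idp y) f f;
  hcomp : forall {x y z x' y' z' : ob}
    {m : pro x y} {n : pro y z} {m' : pro x' y'} {n' : pro y' z'}
    {f : arr x x'} {g : arr y y'} {h : arr z z'},
    cell m m' f g -> cell n n' g h -> cell (compp m n) (compp m' n') f h;
  assoc : forall {x y z w : ob} (m : pro x y) (n : pro y z) (p : pro z w),
    cell (compp (compp m n) p) (compp m (compp n p)) (ida x) (ida w);
  assoc_inv : forall {x y z w : ob} (m : pro x y) (n : pro y z) (p : pro z w),
    cell (compp m (compp n p)) (compp (compp m n) p) (ida x) (ida w);
  lunit : forall {x y : ob} (m : pro x y),
    cell (compp (idp x) m) m (ida x) (ida y);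
  lunit_inv : forall {x y : ob} (m : pro x y),
    cell m (compp (idp x) m) (ida x) (ida y);
  runit : forall {x y : ob} (m : pro x y),
    cell (compp m (idp y)) m (ida x) (ida y);
  runit_inv : forall {x y : ob} (m : pro x y),
    cell m (compp m (idp y)) (ida x) (ida y)
}.

Arguments arr {d} _ _.
Arguments pro {d} _ _.
Arguments cell {d x y w z} _ _ _ _.
Arguments ida {d} x.
Arguments compa {d x y z} _ _.
Arguments idc {d x y} m.
Arguments compc {d x y x' y' x'' y'' m m' m'' f g f' g'} _ _.
Arguments idp {d} x.
Arguments compp {d x y z} _ _.
Arguments idpc {d x y} f.
Arguments hcomp {d x y z x' y' z' m n m' n' f g h} _ _.
Arguments assoc {d x y z w} m n p.
Arguments assoc_inv {d x y z w} m n p.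
Arguments lunit {d x y} m.
Arguments lunit_inv {d x y} m.
Arguments runit {d x y} m.
Arguments runit_inv {d x y} m.

Notation "g ∘ f" := (compa g f) (at level 40, left associativity).
Notation "b ∙ a" := (compc b a) (at level 40, left associativity).
Notation "m ⊙ n" := (compp m n) (at level 38, left associativity).
Notation "a ⊛ b" := (hcomp a b) (at level 38, left associativity).

Definition mutually_inverse (D : dbl_data) (x y : D) (m n : pro x y)
    (a : cell m n (ida x) (ida y)) (b : cell n m (ida x) (ida y)) : Prop :=
  b ∙ a ≡ idc m /\ a ∙ b ≡ idc n.

Definition iso_cell (D : dbl_data) (x y : D) (m n : pro x y)
    (a : cell m n (ida x) (ida y)) : Prop :=
  exists b, mutually_inverse a b.

Record is_double_category (D : dbl_data) : Prop := IsDoubleCategory {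
  compa1 : forall (x y : D) (f : arr x y), f ∘ ida x = f;
  comp1a : forall (x y : D) (f : arr x y), ida y ∘ f = f;
  compaA : forall (x y z w : D) (f : arr x y) (g : arr y z) (h : arr z w),
    h ∘ (g ∘ f) = (h ∘ g) ∘ f;
  compc1 : forall (x y w z : D) (m : pro x y) (n : pro w z) f g
    (a : cell m n f g), a ∙ idc m ≡ a;
  comp1c : forall (x y w z : D) (m : pro x y) (n : pro w z) f g
    (a : cell m n f g), idc n ∙ a ≡ a;
  compcA : forall (x y x' y' x'' y'' x3 y3 : D)
    (m : pro x y) (m' : pro x' y') (m'' : pro x'' y'') (m3 : pro x3 y3)
    f g f' g' f'' g''
    (a : cell m m' f g) (b : cell m' m'' f' g') (c : cell m'' m3 f'' g''),
    c ∙ (b ∙ a) ≡ (c ∙ b) ∙ a;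
  idpc_id : forall x : D, idpc (ida x) = idc (idp x);
  idpc_comp : forall (x y z : D) (f : arr x y) (g : arr y z),
    idpc (g ∘ f) = idpc g ∙ idpc f;
  hcomp_id : forall (x y z : D) (m : pro x y) (n : pro y z),
    idc m ⊛ idc n = idc (m ⊙ n);
  interchange : forall (x y z x' y' z' x'' y'' z'' : D)
    (m : pro x y) (n : pro y z) (m' : pro x' y') (n' : pro y' z')
    (m'' : pro x'' y'') (n'' : pro y'' z'') f g h f' g' h'
    (a : cell m m' f g) (b : cell n n' g h)
    (a' : cell m' m'' f' g') (b' : cell n' n'' g' h'),
    (a' ∙ a) ⊛ (b' ∙ b) = (a' ⊛ b') ∙ (a ⊛ b);
  assoc_iso : forall (x y z w : D) (m : pro x y) (n : pro y z) (p : pro z w),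
    mutually_inverse (assoc m n p) (assoc_inv m n p);
  lunit_iso : forall (x y : D) (m : pro x y),
    mutually_inverse (lunit m) (lunit_inv m);
  runit_iso : forall (x y : D) (m : pro x y),
    mutually_inverse (runit m) (runit_inv m);
  assoc_nat : forall (x y z w x' y' z' w' : D)
    (m : pro x y) (n : pro y z) (p : pro z w)
    (m' : pro x' y') (n' : pro y' z') (p' : pro z' w') f g h k
    (a : cell m m' f g) (b : cell n n' g h) (c : cell p p' h k),
    assoc m' n' p' ∙ (a ⊛ b ⊛ c) ≡ (a ⊛ (b ⊛ c)) ∙ assoc m n p;
  lunit_nat : forall (x y x' y' : D) (m : pro x y) (m' : pro x' y') f g
    (a : cell m m' f g), lunit m' ∙ (idpc f ⊛ a) ≡ a ∙ lunit m;
  runit_nat : forall (x y x' y' : D) (m : pro x y) (m' : pro x' y') f g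
    (a : cell m m' f g), runit m' ∙ (a ⊛ idpc g) ≡ a ∙ runit m;
  pentagon : forall (x y z w v : D)
    (m : pro x y) (n : pro y z) (p : pro z w) (q : pro w v),
    assoc m n (p ⊙ q) ∙ assoc (m ⊙ n) p q
      ≡ (idc m ⊛ assoc n p q) ∙ assoc m (n ⊙ p) q ∙ (assoc m n p ⊛ idc q);
  triangle : forall (x y z : D) (m : pro x y) (n : pro y z),
    (idc m ⊛ lunit n) ∙ assoc m (idp y) n ≡ runit m ⊛ idc n
}.

Record double_category := DoubleCategory {
  dbl :> dbl_data;
  dblP : is_double_category dbl
}.

Section EqOver.
Variables (A B : Type) (T : A -> B -> Type).

Lemma eqo_sym f g f' g' (u : T f g) (v : T f' g') : u ≡ v -> v ≡ u.
Proof. by case. Qed.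

Lemma eqo_trans f g f' g' f'' g'' (u : T f g) (v : T f' g') (w : T f'' g'') :
  u ≡ v -> v ≡ w -> u ≡ w.
Proof. by move=> uv vw; case: vw. Qed.

Lemma eqo_of_eq f g (u v : T f g) : u = v -> u ≡ v.
Proof. by move=> ->. Qed.

Lemma eqo_tot f g f' g' (u : T f g) (v : T f' g') : u ≡ v ->
  existT (fun f => {g & T f g}) f (existT (T f) g u) =
  existT (fun f => {g & T f g}) f' (existT (T f') g' v).
Proof. by case. Qed.

Lemma eq_of_eqo f g (u v : T f g) : u ≡ v -> u = v.
Proof. by move/eqo_tot => e; exact: inj_pair2 (inj_pair2 _ _ _ _ _ e). Qed.

Definition cast_over f g f' g' (ef : f = f') (eg : g = g') (u : T f g) :
  T f' g' := match ef, eg with erefl, erefl => u end.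

Lemma cast_overE f g f' g' (ef : f = f') (eg : g = g') (u : T f g) :
  cast_over ef eg u ≡ u.
Proof. by case: _ / ef; case: _ / eg. Qed.

End EqOver.

Section Congruence.
Variable D : dbl_data.

Lemma compc_congr (x y x' y' x'' y'' : D)
    (m : pro x y) (m' : pro x' y') (m'' : pro x'' y'')
    f1 g1 f2 g2 f1' g1' f2' g2'
    (a1 : cell m m' f1 g1) (a2 : cell m m' f2 g2)
    (b1 : cell m' m'' f1' g1') (b2 : cell m' m'' f2' g2') :
  b1 ≡ b2 -> a1 ≡ a2 -> b1 ∙ a1 ≡ b2 ∙ a2.
Proof. by case; case. Qed.

Lemma hcomp_congr (x y z x' y' z' : D)
    (m : pro x y) (n : pro y z) (m' : pro x' y') (n' : pro y' z')
    f1 g1 h1 f2 g2 h2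
    (a1 : cell m m' f1 g1) (a2 : cell m m' f2 g2)
    (b1 : cell n n' g1 h1) (b2 : cell n n' g2 h2) :
  a1 ≡ a2 -> b1 ≡ b2 -> a1 ⊛ b1 ≡ a2 ⊛ b2.
Proof.
move=> e; case: e b2 => b2 eb; move: (inj_pair2 _ _ _ _ _ (eqo_tot eb)) => e.
suff: forall t : {h & cell n n' g1 h}, existT _ h1 b1 = t ->
  a1 ⊛ b1 ≡ a1 ⊛ projT2 t by move=> /(_ _ e).
by move=> t <-.
Qed.

(** [tot] forgets the sides of a cell, so that [≡] becomes an equality. *)

Definition tcell (x y w z : D) (m : pro x y) (n : pro w z) : Type :=
  {f & {g & cell m n f g}}.

Definition tot (x y w z : D) (m : pro x y) (n : pro w z) f g
  (a : cell m n f g) : tcell m n := existT _ f (existT _ g a).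

Definition tcomp (x y x' y' x'' y'' : D)
    (m : pro x y) (m' : pro x' y') (m'' : pro x'' y'')
    (b : tcell m' m'') (a : tcell m m') : tcell m m'' :=
  tot (projT2 (projT2 b) ∙ projT2 (projT2 a)).

Lemma eqo_of_tot (x y w z : D) (m : pro x y) (n : pro w z) f g f' g'
  (a : cell m n f g) (b : cell m n f' g') : tot a = tot b -> a ≡ b.
Proof.
suff: forall t : tcell m n, tot a = t -> a ≡ projT2 (projT2 t).
  by move=> H /H.
by move=> t <-.
Qed.

Lemma totP (x y w z : D) (m : pro x y) (n : pro w z) f g f' g'
  (a : cell m n f g) (b : cell m n f' g') : a ≡ b -> tot a = tot b.
Proof. by case. Qed.

Lemma tot_comp (x y x' y' x'' y'' : D)
    (m : pro x y) (m' : pro x' y') (m'' : pro x'' y'') f g f' g'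
    (b : cell m' m'' f' g') (a : cell m m' f g) :
  tot (b ∙ a) = tcomp (tot b) (tot a).
Proof. by []. Qed.

End Congruence.

Record lax_data (D E : dbl_data) := LaxData {
  Fob :> D -> E;
  Farr : forall {x y : D}, arr x y -> arr (Fob x) (Fob y);
  Fpro : forall {x y : D}, pro x y -> pro (Fob x) (Fob y);
  Fcell : forall {x y w z : D} {m : pro x y} {n : pro w z}
    {f : arr x w} {g : arr y z},
    cell m n f g -> cell (Fpro m) (Fpro n) (Farr f) (Farr g);
  laxator : forall {x y z : D} (m : pro x y) (n : pro y z),
    cell (Fpro m ⊙ Fpro n) (Fpro (m ⊙ n)) (ida (Fob x)) (ida (Fob z));
  unitor : forall x : D,
    cell (idp (Fob x)) (Fpro (idp x)) (ida (Fob x)) (ida (Fob x))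
}.

Arguments Farr {D E} l {x y} _.
Arguments Fpro {D E} l {x y} _.
Arguments Fcell {D E} l {x y w z m n f g} _.
Arguments laxator {D E} l {x y z} m n.
Arguments unitor {D E} l x.

Record is_lax_functor (D E : dbl_data) (F : lax_data D E) : Prop :=
    IsLaxFunctor {
  Farr_id : forall x : D, Farr F (ida x) = ida (F x);
  Farr_comp : forall (x y z : D) (f : arr x y) (g : arr y z),
    Farr F (g ∘ f) = Farr F g ∘ Farr F f;
  Fcell_id : forall (x y : D) (m : pro x y), Fcell F (idc m) ≡ idc (Fpro F m);
  Fcell_comp : forall (x y x' y' x'' y'' : D)
    (m : pro x y) (m' : pro x' y') (m'' : pro x'' y'') f g f' g'
    (a : cell m m' f g) (b : cell m' m'' f' g'),
    Fcell F (b ∙ a) ≡ Fcell F b ∙ Fcell F a;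
  laxator_nat : forall (x y z x' y' z' : D)
    (m : pro x y) (n : pro y z) (m' : pro x' y') (n' : pro y' z') f g h
    (a : cell m m' f g) (b : cell n n' g h),
    laxator F m' n' ∙ (Fcell F a ⊛ Fcell F b)
      ≡ Fcell F (a ⊛ b) ∙ laxator F m n;
  unitor_nat : forall (x y : D) (f : arr x y),
    unitor F y ∙ idpc (Farr F f) ≡ Fcell F (idpc f) ∙ unitor F x;
  lax_assoc : forall (x y z w : D) (m : pro x y) (n : pro y z) (p : pro z w),
    Fcell F (assoc m n p) ∙ laxator F (m ⊙ n) p
        ∙ (laxator F m n ⊛ idc (Fpro F p))
      ≡ laxator F m (n ⊙ p) ∙ (idc (Fpro F m) ⊛ laxator F n p)
        ∙ assoc (Fpro F m) (Fpro F n) (Fpro F p);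
  lax_lunit : forall (x y : D) (m : pro x y),
    Fcell F (lunit m) ∙ laxator F (idp x) m ∙ (unitor F x ⊛ idc (Fpro F m))
      ≡ lunit (Fpro F m);
  lax_runit : forall (x y : D) (m : pro x y),
    Fcell F (runit m) ∙ laxator F m (idp y) ∙ (idc (Fpro F m) ⊛ unitor F y)
      ≡ runit (Fpro F m)
}.

Record lax_functor (D E : dbl_data) := LaxFunctor {
  lax :> lax_data D E;
  laxP : is_lax_functor lax
}.

Definition is_pseudo (D E : dbl_data) (F : lax_functor D E) : Prop :=
  (forall (x y z : D) (m : pro x y) (n : pro y z), iso_cell (laxator F m n)) /\
  (forall x : D, iso_cell (unitor F x)).

Record nat_trans (D E : dbl_data) (F G : lax_functor D E) := NatTrans {
  tob :> forall x : D, arr (F x) (G x);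
  tpro : forall {x y : D} (m : pro x y),
    cell (Fpro F m) (Fpro G m) (tob x) (tob y);
  tob_nat : forall (x y : D) (f : arr x y),
    tob y ∘ Farr F f = Farr G f ∘ tob x;
  tpro_nat : forall (x y w z : D) (m : pro x y) (n : pro w z) f g
    (a : cell m n f g), tpro n ∙ Fcell F a ≡ Fcell G a ∙ tpro m;
  tpro_laxator : forall (x y z : D) (m : pro x y) (n : pro y z),
    tpro (m ⊙ n) ∙ laxator F m n ≡ laxator G m n ∙ (tpro m ⊛ tpro n);
  tpro_unitor : forall x : D,
    tpro (idp x) ∙ unitor F x ≡ unitor G x ∙ idpc (tob x)
}.

Arguments tpro {D E F G} t {x y} m : rename.

Section Identity.
Variable D : double_category.

Definition lax_id_data : lax_data D D := {|
  Fob := fun x => x;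
  Farr := fun x y f => f;
  Fpro := fun x y m => m;
  Fcell := fun x y w z m n f g a => a;
  laxator := fun x y z m n => idc (m ⊙ n);
  unitor := fun x => idc (idp x) |}.

Lemma lax_id_laws : is_lax_functor lax_id_data.
Proof.
have P := dblP D.
split=> //=.
- move=> *; apply: eqo_trans (comp1c P _) _; exact: eqo_sym (compc1 P _).
- move=> *; apply: eqo_trans (comp1c P _) _; exact: eqo_sym (compc1 P _).
- move=> *; rewrite !(hcomp_id P).
  apply: eqo_trans (compc1 P _) _.
  apply: eqo_trans (compc1 P _) _.
  apply: eqo_sym.
  apply: eqo_trans (compc_congr (compc1 P _) (eq_over_refl _)) _.
  exact: comp1c.
- move=> *; rewrite !(hcomp_id P).
  apply: eqo_trans (compc1 P _) _.
  exact: compc1.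
- move=> *; rewrite !(hcomp_id P).
  apply: eqo_trans (compc1 P _) _.
  exact: compc1.
Qed.

Definition lax_id : lax_functor D D := LaxFunctor lax_id_laws.

End Identity.

Section Composition.
Variables (C D E : double_category).
Variables (G : lax_functor D E) (F : lax_functor C D).

(** The composites of comparison cells of [G] and [F] lie over [G id ∘ id] and
    have to be transported to lie over identities. *)

Lemma Farr_id_comp (x : C) : Farr G (ida (F x)) ∘ ida (G (F x)) = ida (G (F x)).
Proof. by rewrite (compa1 (dblP E)) (Farr_id (laxP G)). Qed.

Definition lax_comp_data : lax_data C E := {|
  Fob := fun x => G (F x);
  Farr := fun x y f => Farr G (Farr F f);
  Fpro := fun x y m => Fpro G (Fpro F m);
  Fcell := fun x y w z m n f g a => Fcell G (Fcell F a);
  laxator := fun x y z m n =>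
    cast_over (Farr_id_comp x) (Farr_id_comp z)
      (Fcell G (laxator F m n) ∙ laxator G (Fpro F m) (Fpro F n));
  unitor := fun x =>
    cast_over (Farr_id_comp x) (Farr_id_comp x)
      (Fcell G (unitor F x) ∙ unitor G (F x)) |}.

Let PE := dblP E.

Lemma tcompA (X : double_category) (x y x' y' x'' y'' x3 y3 : X)
    (m : pro x y) (m' : pro x' y') (m'' : pro x'' y'') (m3 : pro x3 y3)
    (c : tcell m'' m3) (b : tcell m' m'') (a : tcell m m') :
  tcomp c (tcomp b a) = tcomp (tcomp c b) a.
Proof. exact: totP (compcA (dblP X) _ _ _). Qed.

Lemma lax_comp_laws : is_lax_functor lax_comp_data.
Proof.
have LE (x y z : C) (m : pro x y) (n : pro y z) :
    laxator lax_comp_data m n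
      ≡ Fcell G (laxator F m n) ∙ laxator G (Fpro F m) (Fpro F n).
  exact: cast_overE.
have UE (x : C) :
    unitor lax_comp_data x ≡ Fcell G (unitor F x) ∙ unitor G (F x).
  exact: cast_overE.
have GC (x y w z : D) (m : pro x y) (n : pro w z) f g f' g'
    (a : cell m n f g) (b : cell m n f' g') :
    a ≡ b -> tot (Fcell G a) = tot (Fcell G b) by case.
have GM (x y x' y' x'' y'' : D)
    (m : pro x y) (m' : pro x' y') (m'' : pro x'' y'') f g f' g'
    (b : cell m' m'' f' g') (a : cell m m' f g) :
    tcomp (tot (Fcell G b)) (tot (Fcell G a)) = tot (Fcell G (b ∙ a)).
  by rewrite (totP (Fcell_comp (laxP G) a b)).
have idE (X : double_category) (x y : X) (m : pro x y) :
    idc m ≡ idc m ∙ idc m by apply/eqo_sym/(compc1 (dblP X)).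
split.
- by move=> x; rewrite /= !Farr_id //; apply: laxP.
- by move=> *; rewrite /= !Farr_comp //; apply: laxP.
- move=> x y m; apply: eqo_of_tot.
  by rewrite /= (GC _ _ _ _ _ _ _ _ _ _ _ _ (Fcell_id (laxP F) m))
    (totP (Fcell_id (laxP G) _)).
- move=> *; apply: eqo_of_tot.
  by rewrite /= (GC _ _ _ _ _ _ _ _ _ _ _ _ (Fcell_comp (laxP F) _ _))
    (totP (Fcell_comp (laxP G) _ _)).
- move=> x y z x' y' z' m n m' n' f g h a b; apply: eqo_of_tot.
  have E1 := totP (laxator_nat (laxP G) (Fcell F a) (Fcell F b)).
  have E2 := GC _ _ _ _ _ _ _ _ _ _ _ _ (laxator_nat (laxP F) a b).
  rewrite !tot_comp in E1; rewrite -!GM in E2.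
  by rewrite !tot_comp !(totP (LE _ _ _ _ _)) !tot_comp -tcompA E1 !tcompA E2.
- move=> x y f; apply: eqo_of_tot.
  have E1 := totP (unitor_nat (laxP G) (Farr F f)).
  have E2 := GC _ _ _ _ _ _ _ _ _ _ _ _ (unitor_nat (laxP F) f).
  rewrite !tot_comp in E1; rewrite -!GM in E2.
  by rewrite !tot_comp !(totP (UE _)) !tot_comp -tcompA E1 !tcompA E2.
- move=> x y z w m n p; apply: eqo_of_tot.
  have HL : laxator lax_comp_data m n ⊛ idc (Fpro lax_comp_data p)
      ≡ (Fcell G (laxator F m n) ⊛ Fcell G (idc (Fpro F p)))
        ∙ (laxator G (Fpro F m) (Fpro F n) ⊛ idc (Fpro G (Fpro F p))).
    rewrite -(interchange PE); apply: hcomp_congr; first exact: LE.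
    apply: eqo_trans (idE _ _ _ _) _; apply: compc_congr => //.
    exact: eqo_sym (Fcell_id (laxP G) _).
  have HR : idc (Fpro lax_comp_data m) ⊛ laxator lax_comp_data n p
      ≡ (Fcell G (idc (Fpro F m)) ⊛ Fcell G (laxator F n p))
        ∙ (idc (Fpro G (Fpro F m)) ⊛ laxator G (Fpro F n) (Fpro F p)).
    rewrite -(interchange PE); apply: hcomp_congr; last exact: LE.
    apply: eqo_trans (idE _ _ _ _) _; apply: compc_congr => //.
    exact: eqo_sym (Fcell_id (laxP G) _).
  rewrite !tot_comp !(totP (LE _ _ _ _ _)) (totP HL) (totP HR).
  rewrite !tot_comp.
  have E1 := totP (laxator_nat (laxP G) (laxator F m n) (idc (Fpro F p))).
  have E2 := totP (laxator_nat (laxP G) (idc (Fpro F m)) (laxator F n p)).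
  have E3 := GC _ _ _ _ _ _ _ _ _ _ _ _ (lax_assoc (laxP F) m n p).
  have E4 := totP (lax_assoc (laxP G) (Fpro F m) (Fpro F n) (Fpro F p)).
  move: E1 E2 E3 E4; rewrite !tot_comp -!GM => E1 E2 E3 E4.
  rewrite -!tcompA in E1 E2 E3 E4 *.
  rewrite (tcompA (tot (laxator G (Fpro F (m ⊙ n)) _))) E1.
  rewrite (tcompA (tot (laxator G _ (Fpro F (n ⊙ p))))) E2.
  rewrite -!tcompA -E4; rewrite !tcompA in E3 *.
  by rewrite -E3.
- move=> x y m; apply: eqo_of_tot.
  have HL : unitor lax_comp_data x ⊛ idc (Fpro lax_comp_data m)
      ≡ (Fcell G (unitor F x) ⊛ Fcell G (idc (Fpro F m)))
        ∙ (unitor G (F x) ⊛ idc (Fpro G (Fpro F m))).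
    rewrite -(interchange PE); apply: hcomp_congr; first exact: UE.
    apply: eqo_trans (idE _ _ _ _) _; apply: compc_congr => //.
    exact: eqo_sym (Fcell_id (laxP G) _).
  rewrite !tot_comp !(totP (LE _ _ _ _ _)) (totP HL) !tot_comp.
  have E1 := totP (laxator_nat (laxP G) (unitor F x) (idc (Fpro F m))).
  have E3 := GC _ _ _ _ _ _ _ _ _ _ _ _ (lax_lunit (laxP F) m).
  have E4 := totP (lax_lunit (laxP G) (Fpro F m)).
  rewrite !tot_comp in E1 E4; rewrite -!GM in E3.
  rewrite -!tcompA in E1 *; rewrite (tcompA (tot (laxator G _ _))) E1.
  by rewrite !tcompA in E3 E4 *; rewrite E3 E4.
- move=> x y m; apply: eqo_of_tot.
  have HR : idc (Fpro lax_comp_data m) ⊛ unitor lax_comp_data y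
      ≡ (Fcell G (idc (Fpro F m)) ⊛ Fcell G (unitor F y))
        ∙ (idc (Fpro G (Fpro F m)) ⊛ unitor G (F y)).
    rewrite -(interchange PE); apply: hcomp_congr; last exact: UE.
    apply: eqo_trans (idE _ _ _ _) _; apply: compc_congr => //.
    exact: eqo_sym (Fcell_id (laxP G) _).
  rewrite !tot_comp !(totP (LE _ _ _ _ _)) (totP HR) !tot_comp.
  have E1 := totP (laxator_nat (laxP G) (idc (Fpro F m)) (unitor F y)).
  have E3 := GC _ _ _ _ _ _ _ _ _ _ _ _ (lax_runit (laxP F) m).
  have E4 := totP (lax_runit (laxP G) (Fpro F m)).
  rewrite !tot_comp in E1 E4; rewrite -!GM in E3.
  rewrite -!tcompA in E1 *; rewrite (tcompA (tot (laxator G _ _))) E1.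
  by rewrite !tcompA in E3 E4 *; rewrite E3 E4.
Qed.

Definition lax_comp : lax_functor C E := LaxFunctor lax_comp_laws.

End Composition.

(** An adjunction [F ⊣ ra] in the 2-category of double categories, lax double
    functors and natural transformations; each triangle identity, an equation
    between natural transformations, is stated on objects and on proarrows. *)

Record lax_right_adjoint (D E : double_category) (F : lax_functor D E) :=
    LaxRightAdjoint {
  ra :> lax_functor E D;
  ra_unit : nat_trans (lax_id D) (lax_comp ra F);
  ra_counit : nat_trans (lax_comp F ra) (lax_id E);
  triangle_l_ob : forall x : D,
    tob ra_counit (F x) ∘ Farr F (tob ra_unit x) = ida (F x);
  triangle_l_pro : forall (x y : D) (m : pro x y),
    tpro ra_counit (Fpro F m) ∙ Fcell F (tpro ra_unit m) ≡ idc (Fpro F m);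
  triangle_r_ob : forall x : E,
    Farr ra (tob ra_counit x) ∘ tob ra_unit (ra x) = ida (ra x);
  triangle_r_pro : forall (x y : E) (m : pro x y),
    Fcell ra (tpro ra_counit m) ∙ tpro ra_unit (Fpro ra m) ≡ idc (Fpro ra m)
}.

Definition is_restriction (D : dbl_data) (x y w z : D) (n : pro w z)
    (f : arr x w) (g : arr y z) (p : pro x y) (res : cell p n f g) : Prop :=
  forall (u v : D) (h : arr u x) (k : arr v y) (m : pro u v)
    (b : cell m n (f ∘ h) (g ∘ k)),
  exists! a : cell m p h k, res ∙ a = b.

Definition is_equipment (D : double_category) : Prop :=
  forall (x y w z : D) (n : pro w z) (f : arr x w) (g : arr y z),
  exists (p : pro x y) (res : cell p n f g), is_restriction res.

Section Power.
Variables (D : double_category) (I : Type).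

Definition pow_data : dbl_data := {|
  ob := I -> D;
  arr := fun x y => forall i, arr (x i) (y i);
  pro := fun x y => forall i, pro (x i) (y i);
  cell := fun x y w z m n f g => forall i, cell (m i) (n i) (f i) (g i);
  ida := fun x i => ida (x i);
  compa := fun x y z g f i => g i ∘ f i;
  idc := fun x y m i => idc (m i);
  compc := fun _ _ _ _ _ _ _ _ _ _ _ _ _ b a i => b i ∙ a i;
  idp := fun x i => idp (x i);
  compp := fun x y z m n i => m i ⊙ n i;
  idpc := fun x y f i => idpc (f i);
  hcomp := fun _ _ _ _ _ _ _ _ _ _ _ _ _ a b i => a i ⊛ b i;
  assoc := fun _ _ _ _ m n p i => assoc (m i) (n i) (p i);
  assoc_inv := fun _ _ _ _ m n p i => assoc_inv (m i) (n i) (p i);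
  lunit := fun _ _ m i => lunit (m i);
  lunit_inv := fun _ _ m i => lunit_inv (m i);
  runit := fun _ _ m i => runit (m i);
  runit_inv := fun _ _ m i => runit_inv (m i) |}.

Lemma pow_eqo (x y w z : pow_data) (m : pro x y) (n : pro w z) f g f' g'
    (a : cell m n f g) (b : cell m n f' g') :
  (forall i, a i ≡ b i) -> a ≡ b.
Proof.
move=> ab.
have ef : f = f'.
  by apply: functional_extensionality_dep => i; case: (ab i).
have eg : g = g'.
  by apply: functional_extensionality_dep => i; case: (ab i).
subst f' g'; apply: eqo_of_eq; apply: functional_extensionality_dep => i.
exact: eq_of_eqo (ab i).
Qed.

Lemma pow_laws : is_double_category pow_data.
Proof.
have [? ? ? ? ? ? ? ? ? ? iA iL iR ? ? ? ? ?] := dblP D.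
split; try (by move=> *; cbn; apply: functional_extensionality_dep => i; auto);
  try (by move=> *; apply: pow_eqo => i; cbn; auto).
- by move=> x y z w m n p; split; apply: pow_eqo => i; cbn;
    have [] := iA _ _ _ _ (m i) (n i) (p i).
- by move=> x y m; split; apply: pow_eqo => i; cbn; have [] := iL _ _ (m i).
- by move=> x y m; split; apply: pow_eqo => i; cbn; have [] := iR _ _ (m i).
Qed.

Definition pow : double_category := DoubleCategory pow_laws.

Definition diag_data : lax_data D pow := {|
  Fob := fun x => (fun _ => x) : pow;
  Farr := fun x y f _ => f;
  Fpro := fun x y m _ => m;
  Fcell := fun _ _ _ _ _ _ _ _ a _ => a;
  laxator := fun x y z m n _ => idc (m ⊙ n);
  unitor := fun x _ => idc (idp x) |}.

Lemma diag_laws : is_lax_functor diag_data.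
Proof.
have [A1 A2 A3 A4 A5 A6 A7 A8 A9] := laxP (lax_id D).
split=> *; try by []; apply: pow_eqo => i;
  [exact: A5 | exact: A6 | exact: A7 | exact: A8 | exact: A9].
Qed.

Definition diag : lax_functor D pow := LaxFunctor diag_laws.

End Power.

Definition precartesian (D : double_category) : Prop :=
  forall I : finType, inhabited (lax_right_adjoint (diag D I)).

Definition cartesian (D : double_category) : Prop :=
  forall I : finType, exists P : lax_right_adjoint (diag D I), is_pseudo P.

Definition precartesian_equipment (D : double_category) : Prop :=
  is_equipment D /\ precartesian D.

Definition cartesian_equipment (D : double_category) : Prop :=
  is_equipment D /\ cartesian D.

(** A span [A : I ⇸ J] is given by its fibres: [a : A i j] is the assertion
    [a : i ⇸ j].  The legs are the projections from [apex A].  Conversely the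
    fibres of a pair of legs are given by [span_of_legs]. *)

Definition span (I J : finType) : Type := I -> J -> finType.

Definition apex (I J : finType) (A : span I J) : finType :=
  {ij : I * J & A ij.1 ij.2}.

Definition left_leg (I J : finType) (A : span I J) (a : apex A) : I :=
  (tag a).1.

Definition right_leg (I J : finType) (A : span I J) (a : apex A) : J :=
  (tag a).2.

Arguments left_leg {I J} A a.
Arguments right_leg {I J} A a.

Definition span_of_legs (I J A : finType) (l : A -> I) (r : A -> J) :
  span I J := fun i j => {a : A | (l a == i) && (r a == j)}.

Lemma span_of_legsK (I J A : finType) (l : A -> I) (r : A -> J) :
  exists e : A -> apex (span_of_legs l r),
    [/\ bijective e, left_leg _ \o e =1 l & right_leg _ \o e =1 r].
Proof.
have H a : (l a == (l a, r a).1) && (r a == (l a, r a).2) by rewrite !eqxx.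
exists (fun a => Tagged (fun ij => span_of_legs l r ij.1 ij.2)
  (exist _ a (H a) : span_of_legs l r (l a, r a).1 (l a, r a).2)).
split=> //; apply: (@Bijective _ _ _ (fun s => sval (tagged s))) => //.
move=> [[i j] [a /= Ha]]; have [/eqP ei /eqP ej] := andP Ha; move: Ha.
by case: _ / ei; case: _ / ej => Ha; congr existT; apply: val_inj.
Qed.

(** The fibre of the identity span over [(i, j)] is the type of proofs of
    [i = j] itself, so that the identity proarrow on a family can be defined by
    matching on it. *)

Definition id_fibre (I : finType) (i j : I) : Type := i = j.

Definition id_fibre_of_unit (I : finType) (i j : I) (u : unit) :
    option (id_fibre i j) :=
  match @eqP I i j with ReflectT e => Some e | ReflectF _ => None end.

Lemma id_fibreK (I : finType) (i j : I) :
  pcancel (fun _ : id_fibre i j => tt) (id_fibre_of_unit i j).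
Proof.
rewrite /id_fibre_of_unit => e; case: eqP => [e'|]; last by move/(_ e).
by rewrite (eq_irrelevance e' e).
Qed.

HB.instance Definition _ (I : finType) (i j : I) :=
  Finite.copy (id_fibre i j) (pcan_type (@id_fibreK I i j)).

Definition id_span (I : finType) : span I I := fun i j => id_fibre i j.
Arguments id_span I _ _ : clear implicits.

Definition comp_span (I J K : finType) (A : span I J) (B : span J K) :
  span I K := fun i k => {j : J & (A i j * B j k)%type}.

Definition comp_fst (I J K : finType) (A : span I J) (B : span J K)
    (s : apex (comp_span A B)) : apex A :=
  existT (fun ij : I * J => A ij.1 ij.2) ((tag s).1, tag (tagged s))
    (tagged (tagged s)).1.

Definition comp_snd (I J K : finType) (A : span I J) (B : span J K)
    (s : apex (comp_span A B)) : apex B :=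
  existT (fun jk : J * K => B jk.1 jk.2) (tag (tagged s), (tag s).2)
    (tagged (tagged s)).2.

Lemma comp_span_pullback (I J K : finType) (A : span I J) (B : span J K) :
  (forall s : apex (comp_span A B),
     right_leg A (comp_fst s) = left_leg B (comp_snd s)) /\
  (forall (a : apex A) (b : apex B), right_leg A a = left_leg B b ->
     exists! s : apex (comp_span A B), comp_fst s = a /\ comp_snd s = b).
Proof.
split=> // -[[i j] /= a] [[j' k] /= b]; rewrite /right_leg /left_leg /= => e.
case: _ / e b => b.
exists (existT (fun ik : I * K => comp_span A B ik.1 ik.2) (i, k)
  (existT _ j (a, b))); split=> // -[[i' k'] [j0 [a' b']]] [].
rewrite /comp_fst /comp_snd /= => ea eb.
have [ei ej] := f_equal tag ea; have [_ ek] := f_equal tag eb; subst i' j0 k'.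
by rewrite (inj_pair2 _ _ _ _ _ ea) (inj_pair2 _ _ _ _ _ eb).
Qed.

Section Families.
Variable D : double_category.

Record fam := Fam { fidx : finType; fob :> fidx -> D }.

Record fam_arr (X Y : fam) := FamArr {
  fmap : fidx Y -> fidx X;
  farr : forall j : fidx Y, arr (X (fmap j)) (Y j)
}.

Record fam_pro (X Y : fam) := FamPro {
  fspan : span (fidx X) (fidx Y);
  fpro : forall i j, fspan i j -> pro (X i) (Y j)
}.

Record fam_cell (X Y W Z : fam) (M : fam_pro X Y) (N : fam_pro W Z)
    (F : fam_arr X W) (G : fam_arr Y Z) := FamCell {
  fsmap : forall k l, fspan N k l -> fspan M (fmap F k) (fmap G l);
  fcell : forall k l (b : fspan N k l),
    cell (fpro (fsmap b)) (fpro b) (farr F k) (farr G l)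
}.

Definition fam_ida (X : fam) : fam_arr X X :=
  {| fmap := fun i => i; farr := fun i => ida (X i) |}.

Definition fam_compa (X Y Z : fam) (G : fam_arr Y Z) (F : fam_arr X Y) :
    fam_arr X Z :=
  {| fmap := fun k => fmap F (fmap G k);
     farr := fun k => farr G k ∘ farr F (fmap G k) |}.

Definition fam_idc (X Y : fam) (M : fam_pro X Y) :
    fam_cell M M (fam_ida X) (fam_ida Y) :=
  @FamCell _ _ _ _ M M (fam_ida X) (fam_ida Y)
    (fun i j a => a) (fun i j a => idc (fpro a)).

Definition fam_compc (X Y X' Y' X'' Y'' : fam)
    (M : fam_pro X Y) (M' : fam_pro X' Y') (M'' : fam_pro X'' Y'')
    (F : fam_arr X X') (G : fam_arr Y Y')
    (F' : fam_arr X' X'') (G' : fam_arr Y' Y'')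
    (b : fam_cell M' M'' F' G') (a : fam_cell M M' F G) :
    fam_cell M M'' (fam_compa F' F) (fam_compa G' G) :=
  @FamCell _ _ _ _ M M'' (fam_compa F' F) (fam_compa G' G)
    (fun k l c => fsmap a (fsmap b c))
    (fun k l c => fcell b c ∙ fcell a (fsmap b c)).

Definition fam_idp (X : fam) : fam_pro X X :=
  {| fspan := id_span (fidx X);
     fpro := fun i j (e : i = j) =>
       match e in _ = j return pro (X i) (X j) with erefl => idp (X i) end |}.

Definition fam_compp (X Y Z : fam) (M : fam_pro X Y) (N : fam_pro Y Z) :
    fam_pro X Z :=
  @FamPro X Z (comp_span (fspan M) (fspan N))
    (fun i k s => fpro (tagged s).1 ⊙ fpro (tagged s).2).

Definition fam_idpc (X Y : fam) (F : fam_arr X Y) :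
    fam_cell (fam_idp X) (fam_idp Y) F F :=
  @FamCell _ _ _ _ (fam_idp X) (fam_idp Y) F F
    (fun k l (e : k = l) => congr1 (fmap F) e)
    (fun k l (e : k = l) =>
       match e as e' in _ = l' return
         cell (@fpro _ _ (fam_idp X) _ _ (congr1 (fmap F) e'))
              (@fpro _ _ (fam_idp Y) _ _ e') (farr F k) (farr F l')
       with erefl => idpc (farr F k) end).

Definition fam_hcomp (X Y Z X' Y' Z' : fam)
    (M : fam_pro X Y) (N : fam_pro Y Z) (M' : fam_pro X' Y')
    (N' : fam_pro Y' Z')
    (F : fam_arr X X') (G : fam_arr Y Y') (H : fam_arr Z Z')
    (a : fam_cell M M' F G) (b : fam_cell N N' G H) :
    fam_cell (fam_compp M N) (fam_compp M' N') F H :=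
  @FamCell _ _ _ _ (fam_compp M N) (fam_compp M' N') F H
    (fun i k s => existT _ (fmap G (tag s))
       (fsmap a (tagged s).1, fsmap b (tagged s).2))
    (fun i k s => fcell a (tagged s).1 ⊛ fcell b (tagged s).2).

Definition fam_assoc (X Y Z W : fam)
    (M : fam_pro X Y) (N : fam_pro Y Z) (P : fam_pro Z W) :
    fam_cell (fam_compp (fam_compp M N) P) (fam_compp M (fam_compp N P))
      (fam_ida X) (fam_ida W) :=
  @FamCell _ _ _ _ (fam_compp (fam_compp M N) P) (fam_compp M (fam_compp N P))
    (fam_ida X) (fam_ida W)
    (fun i l s => let t := (tagged s).2 in
       existT _ (tag t)
         (existT _ (tag s) ((tagged s).1, (tagged t).1), (tagged t).2))
    (fun i l s => assoc _ _ _).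

Definition fam_assoc_inv (X Y Z W : fam)
    (M : fam_pro X Y) (N : fam_pro Y Z) (P : fam_pro Z W) :
    fam_cell (fam_compp M (fam_compp N P)) (fam_compp (fam_compp M N) P)
      (fam_ida X) (fam_ida W) :=
  @FamCell _ _ _ _ (fam_compp M (fam_compp N P)) (fam_compp (fam_compp M N) P)
    (fam_ida X) (fam_ida W)
    (fun i l s => let t := (tagged s).1 in
       existT _ (tag t)
         ((tagged t).1, existT _ (tag s) ((tagged t).2, (tagged s).2)))
    (fun i l s => assoc_inv _ _ _).

Definition fam_lunit (X Y : fam) (M : fam_pro X Y) :
    fam_cell (fam_compp (fam_idp X) M) M (fam_ida X) (fam_ida Y) :=
  @FamCell _ _ _ _ (fam_compp (fam_idp X) M) M (fam_ida X) (fam_ida Y)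
    (fun i j a => existT _ i (erefl i, a)) (fun i j a => lunit (fpro a)).

Definition fam_runit (X Y : fam) (M : fam_pro X Y) :
    fam_cell (fam_compp M (fam_idp Y)) M (fam_ida X) (fam_ida Y) :=
  @FamCell _ _ _ _ (fam_compp M (fam_idp Y)) M (fam_ida X) (fam_ida Y)
    (fun i j a => existT _ j (a, erefl j)) (fun i j a => runit (fpro a)).

Definition lunit_fibre (X Y : fam) (M : fam_pro X Y) i j
    (s : comp_span (id_span (fidx X)) (fspan M) i j) : fspan M i j :=
  match (tagged s).1 in _ = k return fspan M k j -> fspan M i j with
    erefl => fun a => a end (tagged s).2.

Definition fam_lunit_inv (X Y : fam) (M : fam_pro X Y) :
    fam_cell M (fam_compp (fam_idp X) M) (fam_ida X) (fam_ida Y).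
Proof.
exists (@lunit_fibre X Y M) => i j [k [e a]].
destruct e; exact: lunit_inv.
Defined.

Definition runit_fibre (X Y : fam) (M : fam_pro X Y) i j
    (s : comp_span (fspan M) (id_span (fidx Y)) i j) : fspan M i j :=
  match (tagged s).2 in _ = k return fspan M i k with
    erefl => (tagged s).1 end.

Definition fam_runit_inv (X Y : fam) (M : fam_pro X Y) :
    fam_cell M (fam_compp M (fam_idp Y)) (fam_ida X) (fam_ida Y).
Proof.
exists (@runit_fibre X Y M) => i j [k [a e]].
destruct e; exact: runit_inv.
Defined.

Definition fam_data : dbl_data := {|
  ob := fam;
  arr := fam_arr;
  pro := fam_pro;
  cell := @fam_cell;
  ida := fam_ida;
  compa := @fam_compa;
  idc := @fam_idc;
  compc := @fam_compc;
  idp := fam_idp;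
  compp := @fam_compp;
  idpc := @fam_idpc;
  hcomp := @fam_hcomp;
  assoc := @fam_assoc;
  assoc_inv := @fam_assoc_inv;
  lunit := @fam_lunit;
  lunit_inv := @fam_lunit_inv;
  runit := @fam_runit;
  runit_inv := @fam_runit_inv |}.

Lemma fam_arr_eq (X Y : fam) (F0 : fidx Y -> fidx X)
    (f f' : forall j, arr (X (F0 j)) (Y j)) :
  (forall j, f j = f' j) -> FamArr f = FamArr f'.
Proof. by move=> e; congr FamArr; apply: functional_extensionality_dep. Qed.

Lemma fam_eqo (X Y W Z : fam) (M : fam_pro X Y) (N : fam_pro W Z)
    (F0 : fidx W -> fidx X) (G0 : fidx Z -> fidx Y)
    (f f' : forall k, arr (X (F0 k)) (W k))
    (g g' : forall l, arr (Y (G0 l)) (Z l))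
    (c : @cell fam_data _ _ _ _ M N (FamArr f) (FamArr g))
    (c' : @cell fam_data _ _ _ _ M N (FamArr f') (FamArr g')) :
  (forall k, f k = f' k) -> (forall l, g l = g' l) ->
  (forall k l (b : fspan N k l),
     existT (fun a => tcell (fpro a) (fpro b)) (fsmap c b) (tot (fcell c b)) =
     existT (fun a => tcell (fpro a) (fpro b))
       (fsmap c' b) (tot (fcell c' b))) ->
  c ≡ c'.
Proof.
move=> ef eg; have {}ef : f = f' by apply: functional_extensionality_dep.
have {}eg : g = g' by apply: functional_extensionality_dep.
subst f' g'; case: c c' => [s u] [s' u'] /= e; apply: eqo_of_eq.
have es : s = s'.
  do 3 (apply: functional_extensionality_dep; intro).
  exact: (f_equal tag (e _ _ _)).
subst s'; congr FamCell; do 3 (apply: functional_extensionality_dep; intro).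
apply: eq_of_eqo; apply: eqo_of_tot; exact: inj_pair2 (e _ _ _).
Qed.

Lemma fam_laws : is_double_category fam_data.
Proof.
have P := dblP D.
split.
- by move=> X Y [F0 F]; apply: fam_arr_eq => j; apply: (compa1 P).
- by move=> X Y [F0 F]; apply: fam_arr_eq => j; apply: (comp1a P).
- by move=> X Y Z W [F0 F] [G0 G] [H0 H]; apply: fam_arr_eq => j;
    apply: (compaA P).
- move=> X Y W Z M N [F0 F] [G0 G] c; apply: fam_eqo => *;
    [exact: (compa1 P) | exact: (compa1 P) | ].
  by congr existT; apply: totP; apply: (compc1 P).
- move=> X Y W Z M N [F0 F] [G0 G] c; apply: fam_eqo => *;
    [exact: (comp1a P) | exact: (comp1a P) | ].
  by congr existT; apply: totP; apply: (comp1c P).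
- move=> X Y X' Y' X'' Y'' X3 Y3 M M' M'' M3 [F0 F] [G0 G] [F0' F'] [G0' G'];
  move=> [F0'' F''] [G0'' G''] a b c; apply: fam_eqo => *;
    [exact: (compaA P) | exact: (compaA P) | ].
  by congr existT; apply: totP; apply: (compcA P).
- move=> X; apply: eq_of_eqo; apply: fam_eqo => // k l e.
  by destruct e; congr existT; rewrite /= (idpc_id P).
- move=> X Y Z [F0 F] [G0 G]; apply: eq_of_eqo; apply: fam_eqo => // k l e.
  by destruct e; congr existT; rewrite /= (idpc_comp P).
- move=> X Y Z M N; apply: eq_of_eqo; apply: fam_eqo => // i k [j [a b]].
  by congr existT; rewrite /= (hcomp_id P).
- move=> X Y Z X' Y' Z' X'' Y'' Z'' M N M' N' M'' N'' F G H F' G' H' a b a' b'.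
  apply: eq_of_eqo; apply: fam_eqo => // i k s.
  by congr existT; rewrite /= (interchange P).
- move=> X Y Z W M N Q; split.
  + apply: fam_eqo => [j|j|i l [k [[j [a b]] c]]]; try exact: (compa1 P).
    by congr existT; apply: totP; case: (assoc_iso P (fpro a) (fpro b) (fpro c)).
  + apply: fam_eqo => [j|j|i l [j [a [k [b c]]]]]; try exact: (compa1 P).
    by congr existT; apply: totP; case: (assoc_iso P (fpro a) (fpro b) (fpro c)).
- move=> X Y M; split.
  + apply: fam_eqo => [j|j|i l [k [e a]]]; try exact: (compa1 P).
    by destruct e; congr existT; apply: totP; case: (lunit_iso P (fpro a)).
  + apply: fam_eqo => [j|j|i l a]; try exact: (compa1 P).
    by congr existT; apply: totP; case: (lunit_iso P (fpro a)).
- move=> X Y M; split.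
  + apply: fam_eqo => [j|j|i l [k [a e]]]; try exact: (compa1 P).
    by destruct e; congr existT; apply: totP; case: (runit_iso P (fpro a)).
  + apply: fam_eqo => [j|j|i l a]; try exact: (compa1 P).
    by congr existT; apply: totP; case: (runit_iso P (fpro a)).
- move=> X Y Z W X' Y' Z' W' M N Q M' N' Q' [F0 F] [G0 G] [H0 H] [K0 K] a b c.
  apply: fam_eqo => [j|j|i l s];
    try by (rewrite /= (compa1 P) (comp1a P)).
  by congr existT; apply: totP; apply: (assoc_nat P).
- move=> X Y X' Y' M M' [F0 F] [G0 G] a; apply: fam_eqo => [j|j|i l s];
    try by (rewrite /= (compa1 P) (comp1a P)).
  by congr existT; apply: totP; apply: (lunit_nat P).
- move=> X Y X' Y' M M' [F0 F] [G0 G] a; apply: fam_eqo => [j|j|i l s];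
    try by (rewrite /= (compa1 P) (comp1a P)).
  by congr existT; apply: totP; apply: (runit_nat P).
- move=> X Y Z W V M N Q R.
  apply: fam_eqo => [j|j|i v [j [a [k [b [l [c d]]]]]]];
    try by (rewrite /= !(compa1 P)).
  cbn; refine (f_equal (existT _ _) _).
  exact: totP (pentagon P (fpro a) (fpro b) (fpro c) (fpro d)).
- move=> X Y Z M N; apply: fam_eqo => [j|j|i l s];
    try by (rewrite /= !(compa1 P)).
  by congr existT; apply: totP; apply: (triangle P).
Qed.

Definition FinFam : double_category := DoubleCategory fam_laws.

Definition fam1 (x : D) : FinFam :=
  {| fidx := unit; fob := fun _ => x |}.

Definition fam1_pro (x y : D) (m : pro x y) : pro (fam1 x) (fam1 y) :=
  @FamPro (fam1 x) (fam1 y) (fun _ _ => unit) (fun _ _ _ => m).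

Definition fam1_arr (x y : D) (f : arr x y) : arr (fam1 x) (fam1 y) :=
  @FamArr (fam1 x) (fam1 y) (fun j => j) (fun _ => f).

Definition fam1_cell (x y w z : D) (m : pro x y) (n : pro w z)
    (f : arr x w) (g : arr y z) (a : cell m n f g) :
    cell (fam1_pro m) (fam1_pro n) (fam1_arr f) (fam1_arr g) :=
  @FamCell _ _ _ _ (fam1_pro m) (fam1_pro n) (fam1_arr f) (fam1_arr g)
    (fun _ _ b => b) (fun _ _ _ => a).

Definition fam1_laxator (x y z : D) (m : pro x y) (n : pro y z) :
    cell (fam1_pro m ⊙ fam1_pro n) (fam1_pro (m ⊙ n))
      (ida (fam1 x)) (ida (fam1 z)) :=
  @FamCell _ _ _ _ (fam_compp (fam1_pro m) (fam1_pro n)) (fam1_pro (m ⊙ n))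
    (fam_ida (fam1 x)) (fam_ida (fam1 z))
    (fun _ _ _ => existT _ tt (tt, tt)) (fun _ _ _ => idc (m ⊙ n)).

Definition fam1_unitor (x : D) :
    cell (idp (fam1 x)) (fam1_pro (idp x)) (ida (fam1 x)) (ida (fam1 x)).
Proof.
refine (@FamCell _ _ _ _ (fam_idp (fam1 x)) (fam1_pro (idp x))
  (fam_ida (fam1 x)) (fam_ida (fam1 x))
  (fun k l _ => match k, l return k = l with tt, tt => erefl end) _).
by move=> [] [] []; exact: idc.
Defined.

Definition Delta_data : lax_data D FinFam := {|
  Fob := fam1;
  Farr := fam1_arr;
  Fpro := fam1_pro;
  Fcell := fam1_cell;
  laxator := fam1_laxator;
  unitor := fam1_unitor |}.

Lemma Delta_laws : is_lax_functor Delta_data.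
Proof.
have P := dblP D.
have [A1 A2 A3 A4 A5 A6 A7 A8 A9] := laxP (lax_id D).
split=> //.
- move=> x y z x' y' z' m n m' n' f g h a b; apply: fam_eqo => [j|j|[] [] []];
    try by (rewrite /= (compa1 P) (comp1a P)).
  by congr existT; apply: totP; apply: A5.
- move=> x y f; apply: fam_eqo => [j|j|[] [] []];
    try by (rewrite /= (compa1 P) (comp1a P)).
  by congr existT; apply: totP; apply: A6.
- move=> x y z w m n p; apply: fam_eqo => [j|j|[] [] []];
    try by (rewrite /= !(compa1 P)).
  by congr existT; apply: totP; apply: A7.
- move=> x y m; apply: fam_eqo => [j|j|[] [] []];
    try by (rewrite /= !(compa1 P)).
  by congr existT; apply: totP; apply: A8.
- move=> x y m; apply: fam_eqo => [j|j|[] [] []];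
    try by (rewrite /= !(compa1 P)).
  by congr existT; apply: totP; apply: A9.
Qed.

Definition Delta : lax_functor D FinFam := LaxFunctor Delta_laws.

End Families.

Definition has_lax_finite_products (D : double_category) : Prop :=
  inhabited (lax_right_adjoint (Delta D)).

Definition is_iso_strong (D : double_category)
    (P : lax_right_adjoint (Delta D)) : Prop :=
  (forall X : FinFam D, iso_cell (unitor P X)) /\
  (forall (X Y Z : FinFam D) (M : pro X Y) (N : pro Y Z),
     bijective (right_leg (fspan M)) -> bijective (left_leg (fspan N)) ->
     iso_cell (laxator P M N)).

Definition has_iso_strong_finite_products (D : double_category) : Prop :=
  exists P : lax_right_adjoint (Delta D), is_iso_strong P.

(* Main.v *)
From HB Require Import structures.
From mathcomp Require Import all_boot.
From Stdlib Require Import FunctionalExtensionality ProofIrrelevance.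
From Stdlib Require Import IndefiniteDescription.
Require Import Defs.

(** Everything is a universal property of families of cells.  Call a family of
    cells [c s : P -> m s], over [f s] and [g s], jointly cartesian if every
    family of cells into the [m s] whose sides factor through the [f s] and
    the [g s] factors uniquely through the [c s].  A restriction is a jointly
    cartesian family with one member.  For each finite set [I], the adjunction
    [diag ⊣ ra] says that the projections of the parallel product of a family
    of proarrows are jointly cartesian ([parallel_product_pro]).

    The product of a family of proarrows [M : X ⇸ Y] indexed by a span
    [A : I ⇸ J] is found by taking the parallel product of the [m_a] over the
    apex of [A], a proarrow from the product of the [x_(l a)] to the product
    of the [y_(r a)], and restricting it along the two arrows induced by the
    projections of the products of [X] and of [Y].  Composing a jointly
    cartesian family with a restriction leaves it jointly cartesian, so the
    result has the universal property required of a right adjoint to [Delta]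
    ([prod_pro_exists]).  Conversely, objects and proarrows with these
    universal properties assemble into a lax right adjoint: all its structure
    cells are determined by their composites with the projections, and so are
    the equations between them ([prod_adjoint]).

    Let now the parallel products be pseudo.  A comparison cell is invertible
    as soon as its source, with the evident cells to the factors, is jointly
    cartesian: its target is so already, hence the comparison is a restriction
    along identities.  For the unitor, the source is [idp] of a product; it is
    isomorphic to the parallel product of the [idp (x i)].  For the laxator at
    [M] and [N], when the two legs into [J] are bijections, index everything by
    the apex [C] of the composite span, on which the two families have factors
    [m_c] and [n_c].  The product of [M] is then a restriction of the parallel
    product of the [m_c], that of [N] a restriction of the parallel product of
    the [n_c], and both are restricted in the middle along the same invertible
    arrow [u].  In an equipment the horizontal composite of two such
    restrictions is a restriction ([hcomp_restriction]), here of the composite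
    of two parallel products, which is isomorphic to the parallel product of
    the [m_c ⊙ n_c] ([laxator_iso]). *)

Set Implicit Arguments.
Unset Strict Implicit.
Unset Printing Implicit Defensive.

(** * Cells up to the sides they lie over *)

Lemma eqo_sides (A B : Type) (T : A -> B -> Type) f g f' g'
  (u : T f g) (v : T f' g') : u ≡ v -> f = f' /\ g = g'.
Proof. by case. Qed.

Section Cells.
Variable D : double_category.
Let PD := dblP D.

Lemma tcomp1c (x y x' y' : D) (m : pro x y) (m' : pro x' y')
  (a : tcell m m') : tcomp (tot (idc m')) a = a.
Proof. by case: a => f [g a]; exact: totP (comp1c PD a). Qed.

Lemma tcompc1 (x y x' y' : D) (m : pro x y) (m' : pro x' y')
  (a : tcell m m') : tcomp a (tot (idc m)) = a.
Proof. by case: a => f [g a]; exact: totP (compc1 PD a). Qed.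

(** The sides of [a] are left arbitrary because a composite of cells over
    identities lies over [ida x ∘ ida x], which is only propositionally
    [ida x]. *)
Definition invertible (x y : D) (m n : pro x y) f g (a : cell m n f g) : Prop :=
  exists b : cell n m (ida x) (ida y), b ∙ a ≡ idc m /\ a ∙ b ≡ idc n.

Lemma invertible_comp (x y : D) (m m' m'' : pro x y) f g f' g'
    (b : cell m' m'' f' g') (a : cell m m' f g) :
  invertible b -> invertible a -> invertible (b ∙ a).
Proof.
move=> [b' [/totP Eb1 /totP Eb2]] [a' [/totP Ea1 /totP Ea2]].
rewrite !tot_comp in Eb1 Eb2 Ea1 Ea2.
exists (cast_over (compa1 PD _) (compa1 PD _) (a' ∙ b')).
split; apply: eqo_of_tot; rewrite !tot_comp (totP (cast_overE _ _ _)) tot_comp.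
  by rewrite -!tcompA (tcompA (tot b')) Eb1 tcomp1c.
by rewrite -!tcompA (tcompA (tot a)) Ea2 tcomp1c.
Qed.

Lemma iso_idc (x y : D) (m : pro x y) : iso_cell (idc m).
Proof. by exists (idc m); split; apply: (compc1 PD). Qed.

Lemma iso_hcomp (x y z : D) (m m' : pro x y) (n n' : pro y z)
    (a : cell m m' (ida x) (ida y)) (b : cell n n' (ida y) (ida z)) :
  iso_cell a -> iso_cell b -> iso_cell (a ⊛ b).
Proof.
move=> [a' [a'a aa']] [b' [b'b bb']]; exists (a' ⊛ b').
by split; rewrite -(interchange PD) -(hcomp_id PD); apply: hcomp_congr.
Qed.

Lemma iso_lunit (x y : D) (m : pro x y) : iso_cell (lunit m).
Proof. by eexists; exact: (lunit_iso PD). Qed.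

Lemma iso_runit (x y : D) (m : pro x y) : iso_cell (runit m).
Proof. by eexists; exact: (runit_iso PD). Qed.

Lemma iso_assoc (x y z w : D) (m : pro x y) (n : pro y z) (p : pro z w) :
  iso_cell (assoc m n p).
Proof. by eexists; exact: (assoc_iso PD). Qed.

Lemma iso_inverse (x y : D) (m n : pro x y) (a : cell m n (ida x) (ida y)) b :
  mutually_inverse a b -> iso_cell b.
Proof. by move=> [ba ab]; exists a. Qed.

Lemma hcomp_tot (x y z x' y' z' : D)
    (m : pro x y) (n : pro y z) (m' : pro x' y') (n' : pro y' z')
    f1 g1 h1 f2 g2 h2
    (a1 : cell m m' f1 g1) (a2 : cell m m' f2 g2)
    (b1 : cell n n' g1 h1) (b2 : cell n n' g2 h2) :
  tot a1 = tot a2 -> tot b1 = tot b2 -> tot (a1 ⊛ b1) = tot (a2 ⊛ b2).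
Proof. by move=> ea eb; apply: totP; apply: hcomp_congr; apply: eqo_of_tot. Qed.

(** The inverse of a natural isomorphism is natural. *)
Lemma nat_inv (x y x' y' w z w' z' : D)
    (m : pro x y) (n : pro x' y') (m' : pro w z) (n' : pro w' z')
    fa ga fa' ga' fb gb fb' gb' fc gc fd gd
    (a : cell m n fa ga) (a' : cell n m fa' ga')
    (b : cell m' n' fb gb) (b' : cell n' m' fb' gb')
    (c : cell m m' fc gc) (d : cell n n' fd gd) :
  a ∙ a' ≡ idc n -> b' ∙ b ≡ idc m' -> b ∙ c ≡ d ∙ a -> b' ∙ d ≡ c ∙ a'.
Proof.
move=> /totP Ea /totP Eb /totP E; rewrite !tot_comp in Ea Eb E.
apply: eqo_of_tot; rewrite !tot_comp -[tot d]tcompc1 -Ea (tcompA (tot d)) -E.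
by rewrite -(tcompA (tot b)) (tcompA (tot b')) Eb tcomp1c.
Qed.

End Cells.

Section Restrictions.
Variable D : double_category.
Let PD := dblP D.

Lemma restrictionI (p q w z : D) (P : pro p q) (m : pro w z) f g
    (r : cell P m f g) :
  (forall (u v : D) (n : pro u v) h k (b : cell n m (f ∘ h) (g ∘ k)),
   exists a : cell n P h k, r ∙ a ≡ b) ->
  (forall (u v : D) (n : pro u v) h k (a a' : cell n P h k),
   r ∙ a = r ∙ a' -> a ≡ a') ->
  is_restriction r.
Proof.
move=> ex un u v h k n b; have [a Ha] := ex _ _ _ _ _ b.
exists a; split=> [|a' Ha']; first exact: eq_of_eqo.
by apply/eq_of_eqo/un; rewrite Ha'; apply: eq_of_eqo.
Qed.

Lemma restriction_lift (p q w z : D) (P : pro p q) (m : pro w z) f g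
    (r : cell P m f g) : is_restriction r ->
  forall (u v : D) (n : pro u v) h k f' g' (b : cell n m f' g'),
  f ∘ h = f' -> g ∘ k = g' -> exists a : cell n P h k, r ∙ a ≡ b.
Proof.
move=> R u v n h k f' g' b ef eg; subst f' g'.
by have [a [<- _]] := R _ _ _ _ _ b; exists a.
Qed.

Lemma restriction_ext (p q w z : D) (P : pro p q) (m : pro w z) f g
    (r : cell P m f g) : is_restriction r ->
  forall (u v : D) (n : pro u v) h k h' k'
    (a : cell n P h k) (a' : cell n P h' k'),
  h = h' -> k = k' -> r ∙ a ≡ r ∙ a' -> a ≡ a'.
Proof.
move=> R u v n h k h' k' a a' eh ek; subst h' k' => E.
have [a0 [_ U]] := R u v _ _ n (r ∙ a).
by rewrite -(U a) // -(U a') //; apply/esym/eq_of_eqo.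
Qed.

(** Over identities, restrictions are the same thing as isomorphisms; the
    universal property thus stands in for all constructions of inverses
    below. *)
Lemma iso_restriction (x y : D) (m n : pro x y)
    (a : cell m n (ida x) (ida y)) : iso_cell a -> is_restriction a.
Proof.
move=> [a' [a'a aa']] u v h k l b.
have eh : ida x ∘ (ida x ∘ h) = h by rewrite !(comp1a PD).
have ek : ida y ∘ (ida y ∘ k) = k by rewrite !(comp1a PD).
exists (cast_over eh ek (a' ∙ b)); split.
  apply: eq_of_eqo; apply: eqo_of_tot.
  rewrite tot_comp (totP (cast_overE _ _ _)) tot_comp tcompA -tot_comp.
  by rewrite (totP aa') tcomp1c.
move=> c <-; apply: eq_of_eqo; apply: eqo_of_tot.
rewrite (totP (cast_overE _ _ _)) !tot_comp tcompA -tot_comp.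
by rewrite (totP a'a) tcomp1c.
Qed.

Lemma restriction_iso (x y : D) (m n : pro x y)
    (a : cell m n (ida x) (ida y)) : is_restriction a -> iso_cell a.
Proof.
move=> R.
have [||b Hb] := restriction_lift R (h := ida x) (k := ida y) (idc n);
  try exact: (compa1 PD).
exists b; split=> //; apply: (restriction_ext R); try exact: (compa1 PD).
apply: eqo_of_tot; rewrite !tot_comp tcompA -(tot_comp a b) (totP Hb).
by rewrite tcomp1c (tcompc1 (tot a)).
Qed.

End Restrictions.

(** * Jointly cartesian families of cells *)

(** This is one notion for three: restrictions ([S] a singleton), parallel
    products of proarrows ([S] the indexing set) and products of families
    indexed by a span ([S] its apex). *)
Definition jointly_cartesian (D : dbl_data) (S : Type) (p q : D)
    (P : pro p q) (x y : S -> D) (m : forall s, pro (x s) (y s))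
    (f : forall s, arr p (x s)) (g : forall s, arr q (y s))
    (c : forall s, cell P (m s) (f s) (g s)) : Prop :=
  forall (u v : D) (n : pro u v) (h : arr u p) (k : arr v q)
    (b : forall s, cell n (m s) (f s ∘ h) (g s ∘ k)),
  exists! a : cell n P h k, forall s, c s ∙ a = b s.

Section JointlyCartesian.
Variables (D : double_category) (S : Type) (p q : D) (P : pro p q).
Variables (x y : S -> D) (m : forall s, pro (x s) (y s)).
Variables (f : forall s, arr p (x s)) (g : forall s, arr q (y s)).
Variable c : forall s, cell P (m s) (f s) (g s).
Let PD := dblP D.

(** In applications the sides of the family to be lifted are equal to the
    composites [f s ∘ h], [g s ∘ k] without being convertible to them. *)
Lemma jc_lift : jointly_cartesian c ->
  forall (u v : D) (n : pro u v) h k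
    (f' : forall s, arr u (x s)) (g' : forall s, arr v (y s))
    (b : forall s, cell n (m s) (f' s) (g' s)),
  (forall s, f s ∘ h = f' s) -> (forall s, g s ∘ k = g' s) ->
  exists a : cell n P h k, forall s, c s ∙ a ≡ b s.
Proof.
move=> C u v n h k f' g' b ef eg.
have [a [Ha _]] := C u v n h k (fun s => cast_over (esym (ef s)) (esym (eg s)) (b s)).
exists a => s; rewrite Ha; exact: cast_overE.
Qed.

Lemma jc_ext : jointly_cartesian c ->
  forall (u v : D) (n : pro u v) h k h' k'
    (a : cell n P h k) (a' : cell n P h' k'),
  h = h' -> k = k' -> (forall s, c s ∙ a ≡ c s ∙ a') -> a ≡ a'.
Proof.
move=> C u v n h k h' k' a a' eh ek; subst h' k' => E.
have [a0 [_ U]] := C u v n h k (fun s => c s ∙ a).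
rewrite -(U a) // -(U a') // => s; exact/esym/eq_of_eqo.
Qed.

Lemma jcI :
  (forall (u v : D) (n : pro u v) h k
     (b : forall s, cell n (m s) (f s ∘ h) (g s ∘ k)),
   exists a : cell n P h k, forall s, c s ∙ a ≡ b s) ->
  (forall (u v : D) (n : pro u v) h k (a a' : cell n P h k),
   (forall s, c s ∙ a ≡ c s ∙ a') -> a ≡ a') ->
  jointly_cartesian c.
Proof.
move=> ex un u v n h k b; have [a Ha] := ex _ _ _ _ _ b.
exists a; split=> [s|a' Ha']; first exact: eq_of_eqo.
by apply: eq_of_eqo; apply: un => s; rewrite Ha'.
Qed.

End JointlyCartesian.

Section Factorization.
Variables (D : double_category) (S : Type) (p q : D) (P : pro p q).
Variables (x y : S -> D) (m : forall s, pro (x s) (y s)).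
Variables (f : forall s, arr p (x s)) (g : forall s, arr q (y s)).
Variable c : forall s, cell P (m s) (f s) (g s).
Let PD := dblP D.
Variables (p' q' : D) (Q : pro p' q') (h0 : arr p' p) (k0 : arr q' q).
Variable r : cell Q P h0 k0.
Variables (f' : forall s, arr p' (x s)) (g' : forall s, arr q' (y s)).
Variable c' : forall s, cell Q (m s) (f' s) (g' s).
Hypothesis cr : forall s, c s ∙ r ≡ c' s.

Let ef s : f s ∘ h0 = f' s. Proof. by case: (eqo_sides (cr s)). Qed.
Let eg s : g s ∘ k0 = g' s. Proof. by case: (eqo_sides (cr s)). Qed.

Let crE (u v : D) (n : pro u v) h k (a : cell n Q h k) s :
  c s ∙ (r ∙ a) ≡ c' s ∙ a.
Proof.
by apply: eqo_trans (compcA PD _ _ _) _; apply: compc_congr (cr s) _.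
Qed.

(** The factorization through [c'] is obtained from that through [c] followed
    by that through [r]. *)
Lemma jc_comp : jointly_cartesian c -> is_restriction r -> jointly_cartesian c'.
Proof.
move=> C R; apply: jcI => [u v n h k b|u v n h k a a' E].
  have [||a Ha] := jc_lift C (h := h0 ∘ h) (k := k0 ∘ k) b.
  - by move=> s; rewrite (compaA PD) ef.
  - by move=> s; rewrite (compaA PD) eg.
  have [a1 [Ha1 _]] := R _ _ _ _ _ a; exists a1 => s.
  by apply: eqo_trans (eqo_sym (crE a1 s)) _; rewrite Ha1.
have E2 : r ∙ a ≡ r ∙ a'.
  apply: (jc_ext C) => // s; apply: eqo_trans (crE a s) _.
  exact: eqo_trans (E s) (eqo_sym (crE a' s)).
exact: (restriction_ext R).
Qed.

(** The converse of [jc_comp]; for [h0] and [k0] identities it compares two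
    solutions of the same universal problem. *)
Lemma jc_cancel : jointly_cartesian c -> jointly_cartesian c' -> is_restriction r.
Proof.
move=> C C' u v h k n b.
have [||a Ha] := jc_lift C' (h := h) (k := k) (fun s => c s ∙ b).
- by move=> s; rewrite (compaA PD) ef.
- by move=> s; rewrite (compaA PD) eg.
exists a; split.
  apply: eq_of_eqo; apply: (jc_ext C) => // s.
  exact: eqo_trans (crE a s) (Ha s).
move=> a' Ha'; apply: eq_of_eqo; apply: (jc_ext C') => // s.
apply: eqo_trans (Ha s) _; rewrite -Ha'; exact: crE.
Qed.

End Factorization.

(** An equation at [s] is the equation at any [t] with [sigma t = s], so the
    two families pose the same lifting problems. *)
Lemma jc_reindex (D : double_category) (S T : Type) (sigma : T -> S) (p q : D)
    (P : pro p q) (x y : S -> D) (m : forall s, pro (x s) (y s))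
    (f : forall s, arr p (x s)) (g : forall s, arr q (y s))
    (c : forall s, cell P (m s) (f s) (g s)) :
  (forall s, exists t, sigma t = s) ->
  jointly_cartesian (fun t => c (sigma t)) -> jointly_cartesian c.
Proof.
move=> surj C u v n h k b.
have [a [Ha U]] := C u v n h k (fun t => b (sigma t)).
exists a; split=> [s|a' Ha']; last by apply: U => t; exact: Ha'.
by have [t <-] := surj s; exact: Ha.
Qed.

(** * Horizontal composites of restrictions *)

Section Hcomp.
Variable D : double_category.
Let PD := dblP D.

(** The three following cells are natural isomorphisms built from associators
    and unitors.  They are chosen so that [collapse] below arises by itself when
    a cell into [m ⊙ n] is padded with companions and then projected. *)
Definition shuffle (x y z w v : D) (s : pro x y) (m : pro y z) (n : pro z w)
    (t : pro w v) : cell (s ⊙ ((m ⊙ n) ⊙ t)) ((s ⊙ m) ⊙ (n ⊙ t)) _ _ :=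
  assoc_inv s m (n ⊙ t) ∙ (idc s ⊛ assoc m n t).

Lemma shuffle_nat (x y z w v x' y' z' w' v' : D)
    (s : pro x y) (m : pro y z) (n : pro z w) (t : pro w v)
    (s' : pro x' y') (m' : pro y' z') (n' : pro z' w') (t' : pro w' v')
    f g h k l (a : cell s s' f g) (b : cell m m' g h) (c : cell n n' h k)
    (d : cell t t' k l) :
  shuffle s' m' n' t' ∙ (a ⊛ ((b ⊛ c) ⊛ d))
    ≡ ((a ⊛ b) ⊛ (c ⊛ d)) ∙ shuffle s m n t.
Proof.
have E1 : (idc s' ⊛ assoc m' n' t') ∙ (a ⊛ ((b ⊛ c) ⊛ d))
    ≡ (a ⊛ (b ⊛ (c ⊛ d))) ∙ (idc s ⊛ assoc m n t).
  rewrite -!(interchange PD); apply: hcomp_congr; last exact: (assoc_nat PD).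
  exact: eqo_trans (comp1c PD _) (eqo_sym (compc1 PD _)).
have E2 : assoc_inv s' m' (n' ⊙ t') ∙ (a ⊛ (b ⊛ (c ⊛ d)))
    ≡ ((a ⊛ b) ⊛ (c ⊛ d)) ∙ assoc_inv s m (n ⊙ t).
  have [_ I] := assoc_iso PD s m (n ⊙ t).
  have [I' _] := assoc_iso PD s' m' (n' ⊙ t').
  exact: nat_inv I I' (assoc_nat PD a b (c ⊛ d)).
move/totP: E1; move/totP: E2; rewrite !tot_comp => E2 E1; apply: eqo_of_tot.
by rewrite /shuffle !tot_comp -tcompA E1 !tcompA E2.
Qed.

Definition pad (x y : D) (t : pro x y) :
    cell t (idp x ⊙ (t ⊙ idp y)) _ _ := lunit_inv (t ⊙ idp y) ∙ runit_inv t.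

Lemma pad_nat (x y x' y' : D) (t : pro x y) (t' : pro x' y') f g
    (b : cell t t' f g) :
  (idpc f ⊛ (b ⊛ idpc g)) ∙ pad t ≡ pad t' ∙ b.
Proof.
have [_ I] := lunit_iso PD (t ⊙ idp y).
have [I' _] := lunit_iso PD (t' ⊙ idp y').
have [_ J] := runit_iso PD t; have [J' _] := runit_iso PD t'.
have E1 := totP (nat_inv I I' (lunit_nat PD (b ⊛ idpc g))).
have E2 := totP (nat_inv J J' (runit_nat PD b)).
rewrite !tot_comp in E1 E2; apply: eqo_of_tot.
by rewrite /pad !tot_comp tcompA -E1 -!tcompA E2.
Qed.

Definition collapse (x y z : D) (m : pro x y) (n : pro y z) :
    cell (m ⊙ n) (m ⊙ n) _ _ :=
  (lunit m ⊛ runit n) ∙ (shuffle (idp x) m n (idp z) ∙ pad (m ⊙ n)).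

(** By coherence [collapse m n] is in fact the identity.  Its invertibility,
    which is immediate from its construction, suffices for
    [hcomp_restriction]. *)
Lemma tot_collapse (x y z : D) (m : pro x y) (n : pro y z) :
  tot (collapse m n) = tcomp (tot (lunit m ⊛ runit n))
    (tcomp (tot (shuffle (idp x) m n (idp z))) (tot (pad (m ⊙ n)))).
Proof. by []. Qed.

Lemma collapse_invertible (x y z : D) (m : pro x y) (n : pro y z) :
  invertible (collapse m n).
Proof.
apply: invertible_comp.
  by apply: iso_hcomp; [exact: iso_lunit | exact: iso_runit].
apply: invertible_comp; apply: invertible_comp.
- by apply: iso_inverse; apply: (assoc_iso PD).
- by apply: iso_hcomp; [exact: iso_idc | exact: iso_assoc].
- by apply: iso_inverse; apply: (lunit_iso PD).
- by apply: iso_inverse; apply: (runit_iso PD).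
Qed.

Hypothesis eqD : is_equipment D.

(** The companion of [f] is the restriction of [idp w] along [f] and [ida w],
    its conjoint the one along [ida w] and [f].  The factorization [e ∙ i] of
    [idpc f] is the one through the restriction [e]. *)
Lemma has_companion (x w : D) (f : arr x w) :
  exists (fs : pro x w) (e : cell fs (idp w) f (ida w))
    (i : cell (idp x) fs (ida x) f), e ∙ i ≡ idpc f.
Proof.
have [fs [e R]] := eqD (idp w) f (ida w).
have [||i Hi] := restriction_lift R (h := ida x) (k := f) (idpc f).
- exact: (compa1 PD).
- exact: (comp1a PD).
by exists fs, e, i.
Qed.

Lemma has_conjoint (x w : D) (f : arr x w) :
  exists (fs : pro w x) (e : cell fs (idp w) (ida w) f)
    (i : cell (idp x) fs f (ida x)), e ∙ i ≡ idpc f.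
Proof.
have [fs [e R]] := eqD (idp w) (ida w) f.
have [||i Hi] := restriction_lift R (h := f) (k := ida x) (idpc f).
- exact: (comp1a PD).
- exact: (compa1 PD).
by exists fs, e, i.
Qed.

(** A cell [b] into [m ⊙ n] over [f ∘ h] and [g ∘ k] becomes a cell into
    [fs ⊙ ((m ⊙ n) ⊙ gs)] over [h] and [k], where [fs] is the companion of [f]
    and [gs] the conjoint of [g].  Rebracketing gives [(fs ⊙ m) ⊙ (n ⊙ gs)],
    which maps to [p ⊙ q]: the cell [fs ⊙ m -> m] over [f] on the left and an
    identity on the right factors through [r1] because [u] has a right inverse
    [u'], and similarly [n ⊙ gs -> n] factors through [r2].  Call the resulting
    cell [T b].  Then [(r1 ⊛ r2) ∙ T b = collapse m n ∙ b] and
    [T ((r1 ⊛ r2) ∙ a) = collapse p q ∙ a], which give existence and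
    uniqueness of factorizations since [collapse] is invertible. *)
Lemma hcomp_restriction (x y x' w z w' : D) (p : pro x y) (q : pro y x')
    (m : pro w z) (n : pro z w') f u g (r1 : cell p m f u) (r2 : cell q n u g)
    (u' : arr z y) :
  u ∘ u' = ida z -> u' ∘ u = ida y ->
  is_restriction r1 -> is_restriction r2 -> is_restriction (r1 ⊛ r2).
Proof.
move=> uu' u'u R1 R2.
have [fs [e [i ei]]] := has_companion f.
have [gs [e' [i' ei']]] := has_conjoint g.
have [||phi Hphi] := restriction_lift R1 (h := ida x) (k := u')
  (lunit m ∙ (e ⊛ idc m)).
- by rewrite (compa1 PD) (comp1a PD).
- by rewrite (compa1 PD).
have [||psi Hpsi] := restriction_lift R2 (h := u') (k := ida x')
  (runit n ∙ (idc n ⊛ e')).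
- by rewrite (compa1 PD).
- by rewrite (compa1 PD) (comp1a PD).
have Ephi : phi ∙ (i ⊛ r1) ≡ lunit p.
  apply: (restriction_ext R1); rewrite ?(compa1 PD) //.
  apply: eqo_of_tot; rewrite tot_comp [tot (phi ∙ _)]tot_comp tcompA.
  rewrite -(tot_comp r1 phi) (totP Hphi) -(totP (lunit_nat PD r1)).
  rewrite !tot_comp -tcompA; congr tcomp.
  rewrite -tot_comp -(interchange PD).
  apply: hcomp_tot; [exact: totP | exact: totP (comp1c PD _)].
have Epsi : psi ∙ (r2 ⊛ i') ≡ runit q.
  apply: (restriction_ext R2); rewrite ?(compa1 PD) //.
  apply: eqo_of_tot; rewrite tot_comp [tot (psi ∙ _)]tot_comp tcompA.
  rewrite -(tot_comp r2 psi) (totP Hpsi) -(totP (runit_nat PD r2)).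
  rewrite !tot_comp -tcompA; congr tcomp.
  rewrite -tot_comp -(interchange PD).
  apply: hcomp_tot; [exact: totP (comp1c PD _) | exact: totP].
(* [b] is padded with [i] and [i'], rebracketed, then projected to [p ⊙ q]. *)
pose T (s t : D) h k (l : pro s t) (b : cell l (m ⊙ n) (f ∘ h) (g ∘ k)) :=
  (phi ⊛ psi) ∙ (shuffle fs m n gs
    ∙ (((i ∙ idpc h) ⊛ (b ⊛ (i' ∙ idpc k))) ∙ pad l)).
have totT (s t : D) h k (l : pro s t) (b : cell l (m ⊙ n) (f ∘ h) (g ∘ k)) :
    tot (T _ _ _ _ _ b) = tcomp (tot (phi ⊛ psi))
      (tcomp (tot (shuffle fs m n gs))
      (tcomp (tot ((i ∙ idpc h) ⊛ (b ⊛ (i' ∙ idpc k)))) (tot (pad l)))) by [].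
have TE (s t : D) h k (l : pro s t) (b : cell l (m ⊙ n) (f ∘ h) (g ∘ k)) :
    (r1 ⊛ r2) ∙ T _ _ _ _ _ b ≡ collapse m n ∙ b.
  have E1 : (r1 ⊛ r2) ∙ (phi ⊛ psi)
     ≡ (lunit m ⊛ runit n) ∙ ((e ⊛ idc m) ⊛ (idc n ⊛ e')).
    by rewrite -!(interchange PD); apply: hcomp_congr.
  have E2 : (e ⊛ ((idc m ⊛ idc n) ⊛ e')) ∙
      ((i ∙ idpc h) ⊛ (b ⊛ (i' ∙ idpc k)))
      ≡ idpc (f ∘ h) ⊛ (b ⊛ idpc (g ∘ k)).
    rewrite -!(interchange PD) (hcomp_id PD) !(idpc_comp PD).
    apply: hcomp_congr; last apply: hcomp_congr; last first.
    - apply: eqo_trans (compcA PD _ _ _) _; exact: compc_congr.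
    - exact: (comp1c PD).
    - apply: eqo_trans (compcA PD _ _ _) _; exact: compc_congr.
  have SN := totP (shuffle_nat e (idc m) (idc n) e').
  have PN := totP (pad_nat b); move/totP: E2 => E2; move/totP: E1 => E1.
  rewrite tot_comp [RHS]tot_comp in SN; rewrite tot_comp [RHS]tot_comp in PN.
  rewrite tot_comp in E2; rewrite tot_comp [RHS]tot_comp in E1.
  apply: eqo_of_tot; rewrite tot_comp [RHS]tot_comp totT tot_collapse.
  rewrite [LHS]tcompA E1 -!tcompA; congr tcomp.
  rewrite [LHS]tcompA -SN -!tcompA; congr tcomp.
  by rewrite [LHS]tcompA E2 PN.
have ET (s t : D) h k (l : pro s t) (a : cell l (p ⊙ q) h k) b :
    (r1 ⊛ r2) ∙ a = b -> collapse p q ∙ a ≡ T _ _ _ _ _ b.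
  move=> <-.
  have E2 : (i ∙ idpc h) ⊛ (((r1 ⊛ r2) ∙ a) ⊛ (i' ∙ idpc k)) =
      (i ⊛ ((r1 ⊛ r2) ⊛ i')) ∙ (idpc h ⊛ (a ⊛ idpc k)).
    by rewrite -!(interchange PD).
  have E3 : (phi ⊛ psi) ∙ ((i ⊛ r1) ⊛ (r2 ⊛ i')) ≡ lunit p ⊛ runit q.
    by rewrite -(interchange PD); apply: hcomp_congr.
  have SN := totP (shuffle_nat i r1 r2 i'); have PN := totP (pad_nat a).
  move/totP: E3 => E3; rewrite tot_comp [RHS]tot_comp in SN.
  rewrite tot_comp [RHS]tot_comp in PN; rewrite tot_comp in E3.
  apply: eqo_of_tot; rewrite tot_comp totT tot_collapse E2 tot_comp.
  by rewrite -!tcompA PN [X in _ = tcomp _ X]tcompA SN -!tcompA [RHS]tcompA E3.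
have [c [_ /totP Ec]] := collapse_invertible m n.
have [d [/totP Ed _]] := collapse_invertible p q.
rewrite !tot_comp in Ec Ed.
apply: restrictionI => [s t l h k b|s t l h k a a' Ea].
  have e1 : ida w ∘ (f ∘ h) = f ∘ h by rewrite (comp1a PD).
  have e2 : ida w' ∘ (g ∘ k) = g ∘ k by rewrite (comp1a PD).
  (* [T] inverts [r1 ⊛ r2] up to [collapse m n], whose inverse is [c]. *)
  pose b' := cast_over e1 e2 (c ∙ b).
  have s1 : ida x ∘ (ida x ∘ ida x ∘ (ida x ∘ h ∘ (ida s ∘ ida s))) = h.
    by rewrite !(comp1a PD) !(compa1 PD).
  have s2 : ida x' ∘ (ida x' ∘ ida x' ∘ (ida x' ∘ k ∘ (ida t ∘ ida t))) = k.
    by rewrite !(comp1a PD) !(compa1 PD).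
  exists (cast_over s1 s2 (T _ _ _ _ _ b')); apply: eqo_of_tot.
  rewrite tot_comp (totP (cast_overE _ _ _)) -tot_comp (totP (TE _ _ _ _ _ _)).
  by rewrite tot_comp (totP (cast_overE _ _ _)) tot_comp tcompA Ec tcomp1c.
have E := totP (ET _ _ _ _ _ a _ erefl).
rewrite Ea -(totP (ET _ _ _ _ _ a' _ erefl)) !tot_comp in E.
by apply: eqo_of_tot; rewrite -[tot a]tcomp1c -Ed -tcompA E tcompA Ed tcomp1c.
Qed.

End Hcomp.

(** * Universal properties from an adjunction *)

Section Adjunction.
Variables (D E : double_category) (F : lax_functor D E).
Variable P : lax_right_adjoint F.
Let PD := dblP D.
Let PE := dblP E.

Definition counit_ob (x : E) : arr (F (P x)) x := tob (ra_counit P) x.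
Definition counit_pro (x y : E) (m : pro x y) :
  cell (Fpro F (Fpro P m)) m (counit_ob x) (counit_ob y) :=
  tpro (ra_counit P) m.

(** Transposing an arrow twice gives it back; [transpose_pro] is the same fact
    for cells. *)
Lemma transpose_ob (x : E) (w : D) (h : arr w (P x)) :
  Farr P (counit_ob x ∘ Farr F h) ∘ tob (ra_unit P) w = h.
Proof.
rewrite (Farr_comp (laxP P)) -(compaA PD).
have /= <- := tob_nat (ra_unit P) h.
by rewrite (compaA PD) (triangle_r_ob P) (comp1a PD).
Qed.

Lemma adjunction_ob (x : E) (w : D) (f : arr (F w) x) :
  exists! h : arr w (P x), counit_ob x ∘ Farr F h = f.
Proof.
exists (Farr P f ∘ tob (ra_unit P) w); split=> [|h <-].
  rewrite (Farr_comp (laxP F)) (compaA PE).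
  have /= -> := tob_nat (ra_counit P) f.
  by rewrite -(compaA PE) (triangle_l_ob P) (compa1 PE).
exact: transpose_ob.
Qed.

Lemma transpose_pro (x y : E) (m : pro x y) (u v : D) (n : pro u v) h k
    (a : cell n (Fpro P m) h k) :
  Fcell P (counit_pro m ∙ Fcell F a) ∙ tpro (ra_unit P) n ≡ a.
Proof.
apply: eqo_of_tot; rewrite tot_comp (totP (Fcell_comp (laxP P) _ _)) tot_comp.
have /totP /= E1 := tpro_nat (ra_unit P) a; rewrite !tot_comp in E1.
have /totP E2 := triangle_r_pro P m; rewrite tot_comp in E2.
by rewrite -tcompA -E1 tcompA E2 tcomp1c.
Qed.

Lemma adjunction_pro (x y : E) (m : pro x y) (u v : D) (n : pro u v) h k
    (b : cell (Fpro F n) m (counit_ob x ∘ Farr F h) (counit_ob y ∘ Farr F k)) :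
  exists! a : cell n (Fpro P m) h k, counit_pro m ∙ Fcell F a = b.
Proof.
pose a := cast_over (transpose_ob h) (transpose_ob k)
  (Fcell P b ∙ tpro (ra_unit P) n).
have Ea : a ≡ Fcell P b ∙ tpro (ra_unit P) n by exact: cast_overE.
have FE : tot (Fcell F a) = tot (Fcell F (Fcell P b ∙ tpro (ra_unit P) n)).
  by case: Ea.
exists a; split=> [|a' H]; last first.
  by apply: eq_of_eqo; apply: eqo_trans Ea _; rewrite -H; exact: transpose_pro.
apply: eq_of_eqo; apply: eqo_of_tot.
rewrite tot_comp FE (totP (Fcell_comp (laxP F) _ _)) tot_comp.
have /totP /= E1 := tpro_nat (ra_counit P) b; rewrite !tot_comp in E1.
have /totP E2 := triangle_l_pro P n; rewrite tot_comp in E2.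
by rewrite tcompA E1 -tcompA E2 (tcompc1 (tot b)).
Qed.

End Adjunction.

(** * Parallel products *)

Section ParallelProducts.
Variables (D : double_category) (I : finType).
Variable P : lax_right_adjoint (diag D I).
Let PD := dblP D.

Definition parallel_proj (x : pow D I) (i : I) : arr (P x) (x i) :=
  counit_ob P x i.
Definition parallel_cproj (x y : pow D I) (m : pro x y) (i : I) :
  cell (Fpro P m) (m i) (parallel_proj x i) (parallel_proj y i) :=
  counit_pro P m i.

Lemma parallel_product (x : pow D I) (w : D) (f : forall i, arr w (x i)) :
  exists! h : arr w (P x), forall i, parallel_proj x i ∘ h = f i.
Proof.
have [h [Hh U]] := @adjunction_ob _ _ _ P x w f.
exists h; split=> [i|h' E]; first by rewrite -Hh.
by apply: U; apply: functional_extensionality_dep.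
Qed.

Lemma parallel_product_pro (x y : pow D I) (m : pro x y) :
  jointly_cartesian (parallel_cproj m).
Proof.
move=> u v n h k b.
have [a [Ha U]] := @adjunction_pro _ _ _ P _ _ m _ _ n h k b.
exists a; split=> [i|a' E]; first by rewrite -Ha.
by apply: U; apply: functional_extensionality_dep.
Qed.

Lemma pow_eqo_proj (x y w z : pow D I) (m : pro x y) (n : pro w z) f g f' g'
    (a : cell m n f g) (b : cell m n f' g') i : a ≡ b -> a i ≡ b i.
Proof. by case. Qed.

(** The counit of the adjunction is compatible with the comparison cells; those
    of [diag] are identities, which leaves the comparison cells of [P]. *)
Lemma parallel_laxator (x y z : pow D I) (m : pro x y) (n : pro y z) i :
  parallel_cproj (m ⊙ n) i ∙ laxator P m n
    ≡ parallel_cproj m i ⊛ parallel_cproj n i.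
Proof.
have E := tpro_laxator (ra_counit P) m n.
have := eqo_trans (compc_congr (eq_over_refl _) (eqo_sym (cast_overE _ _ _))) E.
move=> /(@pow_eqo_proj _ _ _ _ _ _ _ _ _ _ _ _ i)/totP /= E'.
apply: eqo_of_tot; rewrite !tot_comp in E' *.
by rewrite tcompc1 tcomp1c in E'.
Qed.

Lemma parallel_unitor (x : pow D I) i :
  parallel_cproj (idp x) i ∙ unitor P x ≡ idpc (parallel_proj x i).
Proof.
have E := tpro_unitor (ra_counit P) x.
have := eqo_trans (compc_congr (eq_over_refl _) (eqo_sym (cast_overE _ _ _))) E.
move=> /(@pow_eqo_proj _ _ _ _ _ _ _ _ _ _ _ _ i)/totP /= E'.
apply: eqo_of_tot; rewrite !tot_comp in E' *.
by rewrite tcompc1 tcomp1c in E'.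
Qed.

End ParallelProducts.

Arguments parallel_proj {D I} P x i.
Arguments parallel_cproj {D I} P {x y} m i.
Arguments parallel_product_pro {D I} P {x y} m.

(** * The lax right adjoint given by products of finite families *)

(** The universal objects and proarrows which determine a lax right adjoint of
    [Delta].  The projections of a product of proarrows are indexed by the apex
    of the span, so that they form a single family of cells. *)
Record products (D : double_category) := Products {
  prod_ob : fam D -> D;
  proj : forall (X : fam D) i, arr (prod_ob X) (X i);
  projP : forall (X : fam D) w (f : forall i, arr w (X i)),
    exists! h : arr w (prod_ob X), forall i, proj i ∘ h = f i;
  prod_pro : forall X Y : fam D, fam_pro X Y -> pro (prod_ob X) (prod_ob Y);
  apex_cproj : forall (X Y : fam D) (M : fam_pro X Y) (s : apex (fspan M)),
    cell (prod_pro M) (fpro (tagged s))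
      (@proj X (tag s).1) (@proj Y (tag s).2);
  apex_cprojP : forall (X Y : fam D) (M : fam_pro X Y),
    jointly_cartesian (@apex_cproj X Y M)
}.

Arguments prod_ob {D} p X : rename.
Arguments proj {D} p X i : rename.
Arguments projP {D} p {X w} f : rename.
Arguments prod_pro {D} p {X Y} M : rename.
Arguments apex_cproj {D} p {X Y M} s : rename.
Arguments apex_cprojP {D} p {X Y} M : rename.

Section Products.
Variables (D : double_category) (Q : products D).
Let PD := dblP D.

Definition tuple (X : fam D) w (f : forall i, arr w (X i)) : arr w (prod_ob Q X) :=
  proj1_sig (constructive_indefinite_description _ (projP Q f)).

Lemma proj_tuple (X : fam D) w (f : forall i, arr w (X i)) i :
  proj Q X i ∘ tuple f = f i.
Proof.
by rewrite /tuple; case: constructive_indefinite_description => h [].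
Qed.

Lemma proj_ext (X : fam D) w (h k : arr w (prod_ob Q X)) :
  (forall i, proj Q X i ∘ h = proj Q X i ∘ k) -> h = k.
Proof.
move=> E; have [h0 [_ U]] := projP Q (fun i => proj Q X i ∘ h).
by rewrite -(U h) // -(U k).
Qed.

(** Cells of families are given fibrewise, hence the curried form of the
    projections. *)
Definition cproj (X Y : fam D) (M : fam_pro X Y) i j (s : fspan M i j) :
    cell (prod_pro Q M) (fpro s) (proj Q X i) (proj Q Y j) :=
  apex_cproj Q (existT (fun ij => fspan M ij.1 ij.2) (i, j) s).

Lemma cproj_ext (X Y : fam D) (M : fam_pro X Y) (u v : D) (n : pro u v)
    h k h' k' (a : cell n (prod_pro Q M) h k) (a' : cell n (prod_pro Q M) h' k') :
  h = h' -> k = k' ->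
  (forall i j (s : fspan M i j), cproj s ∙ a ≡ cproj s ∙ a') -> a ≡ a'.
Proof.
move=> eh ek E; apply: (jc_ext (apex_cprojP Q M)) eh ek _ => -[[i j] s].
exact: E.
Qed.

Lemma lift_ex (X Y : fam D) (M : fam_pro X Y) (u v : D) (n : pro u v) h k f g
    (b : forall i j (s : fspan M i j), cell n (fpro s) (f i) (g j)) :
  (forall i, proj Q X i ∘ h = f i) -> (forall j, proj Q Y j ∘ k = g j) ->
  exists a : cell n (prod_pro Q M) h k,
    forall i j (s : fspan M i j), cproj s ∙ a ≡ b i j s.
Proof.
move=> ef eg.
have [||a Ha] := jc_lift (apex_cprojP Q M) (h := h) (k := k)
  (fun s => b (tag s).1 (tag s).2 (tagged s)); try by [].
by exists a => i j s; have := Ha (existT _ (i, j) s).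
Qed.

(** The equations [ef] and [eg] let the structure cells be lifted directly over
    identities and over values of [prod_arr], so that no transport occurs in
    their types. *)
Definition lift (X Y : fam D) (M : fam_pro X Y) (u v : D) (n : pro u v) h k f g
    (b : forall i j (s : fspan M i j), cell n (fpro s) (f i) (g j))
    (ef : forall i, proj Q X i ∘ h = f i) (eg : forall j, proj Q Y j ∘ k = g j) :
    cell n (prod_pro Q M) h k :=
  proj1_sig (constructive_indefinite_description _ (lift_ex b ef eg)).

Lemma cproj_lift (X Y : fam D) (M : fam_pro X Y) (u v : D) (n : pro u v) h k f g
    (b : forall i j (s : fspan M i j), cell n (fpro s) (f i) (g j))
    (ef : forall i, proj Q X i ∘ h = f i) (eg : forall j, proj Q Y j ∘ k = g j)
    i j (s : fspan M i j) : cproj s ∙ lift b ef eg ≡ b i j s.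
Proof. by rewrite /lift; case: constructive_indefinite_description. Qed.

Definition prod_arr (X Y : fam D) (F : fam_arr X Y) :
    arr (prod_ob Q X) (prod_ob Q Y) :=
  tuple (fun j => farr F j ∘ proj Q X (fmap F j)).

Lemma proj_prod_arr (X Y : fam D) (F : fam_arr X Y) j :
  proj Q Y j ∘ prod_arr F = farr F j ∘ proj Q X (fmap F j).
Proof. exact: proj_tuple. Qed.

Definition prod_cell (X Y W Z : fam D) (M : fam_pro X Y) (N : fam_pro W Z)
    (F : fam_arr X W) (G : fam_arr Y Z) (c : fam_cell M N F G) :
    cell (prod_pro Q M) (prod_pro Q N) (prod_arr F) (prod_arr G) :=
  lift (fun k l (b : fspan N k l) => fcell c b ∙ cproj (fsmap c b))
    (proj_prod_arr F) (proj_prod_arr G).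

Lemma cproj_prod_cell (X Y W Z : fam D) (M : fam_pro X Y) (N : fam_pro W Z)
    (F : fam_arr X W) (G : fam_arr Y Z) (c : fam_cell M N F G) k l
    (b : fspan N k l) :
  tcomp (tot (cproj b)) (tot (prod_cell c))
    = tcomp (tot (fcell c b)) (tot (cproj (fsmap c b))).
Proof. exact: totP (cproj_lift _ _ _ _). Qed.

Let proj_ida X i : proj Q X i ∘ ida (prod_ob Q X) = proj Q X i := compa1 PD _.

Definition prod_laxator (X Y Z : fam D) (M : fam_pro X Y) (N : fam_pro Y Z) :
    cell (prod_pro Q M ⊙ prod_pro Q N) (prod_pro Q (fam_compp M N))
      (ida (prod_ob Q X)) (ida (prod_ob Q Z)) :=
  @lift X Z (fam_compp M N) _ _ _ _ _ _ _
    (fun i k s => cproj (tagged s).1 ⊛ cproj (tagged s).2)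
    (@proj_ida X) (@proj_ida Z).

Lemma cproj_prod_laxator (X Y Z : fam D) (M : fam_pro X Y) (N : fam_pro Y Z)
    i k (s : fspan (fam_compp M N) i k) :
  tcomp (tot (@cproj X Z (fam_compp M N) i k s)) (tot (prod_laxator M N))
    = tot (cproj (tagged s).1 ⊛ cproj (tagged s).2).
Proof. exact: totP (@cproj_lift X Z (fam_compp M N) _ _ _ _ _ _ _ _ _ _ _ _ _). Qed.

Definition prod_unitor (X : fam D) :
    cell (idp (prod_ob Q X)) (prod_pro Q (fam_idp X))
      (ida (prod_ob Q X)) (ida (prod_ob Q X)) :=
  @lift X X (fam_idp X) _ _ _ _ _ _ _
    (fun i j (e : i = j) => match e as e' in _ = j' return
         cell (idp (prod_ob Q X)) (@fpro _ _ _ (fam_idp X) _ _ e')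
           (proj Q X i) (proj Q X j') with
       erefl => idpc (proj Q X i) end)
    (@proj_ida X) (@proj_ida X).

Lemma cproj_prod_unitor (X : fam D) i :
  tcomp (tot (@cproj X X (fam_idp X) i i (erefl i))) (tot (prod_unitor X))
    = tot (idpc (proj Q X i)).
Proof. exact: totP (@cproj_lift X X (fam_idp X) _ _ _ _ _ _ _ _ _ _ _ _ _). Qed.

Definition prod_data : lax_data (FinFam D) D := {|
  Fob := prod_ob Q : FinFam D -> D;
  Farr := prod_arr;
  Fpro := @prod_pro D Q;
  Fcell := prod_cell;
  laxator := prod_laxator;
  unitor := prod_unitor |}.

Lemma prod_arr_id (X : fam D) : prod_arr (fam_ida X) = ida (prod_ob Q X).
Proof.
by apply: proj_ext => i; rewrite proj_prod_arr (comp1a PD) (compa1 PD).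
Qed.

Lemma prod_arr_comp (X Y Z : fam D) (F : fam_arr X Y) (G : fam_arr Y Z) :
  prod_arr (fam_compa G F) = prod_arr G ∘ prod_arr F.
Proof.
apply: proj_ext => i; rewrite proj_prod_arr (compaA PD) proj_prod_arr.
by rewrite -!(compaA PD) proj_prod_arr.
Qed.

(** Each law is checked after composition with a projection, where the
    structure cells compute by the lemmas above; it then becomes a law of [D],
    in most cases the naturality of the corresponding structure cell. *)
Lemma prod_laws : is_lax_functor prod_data.
Proof.
split.
- exact: prod_arr_id.
- exact: prod_arr_comp.
- move=> X Y M; apply: cproj_ext => [||i j s]; try exact: prod_arr_id.
  apply: eqo_of_tot; rewrite !tot_comp cproj_prod_cell tcomp1c.
  by rewrite (tcompc1 (tot (cproj s))).
- move=> X Y X' Y' X'' Y'' M M' M'' F G F' G' a b.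
  apply: cproj_ext => [||i j s]; try exact: prod_arr_comp.
  apply: eqo_of_tot; rewrite !tot_comp cproj_prod_cell tcompA cproj_prod_cell.
  by rewrite -[RHS]tcompA cproj_prod_cell [RHS]tcompA.
- move=> X Y Z X' Y' Z' M N M' N' F G H a b.
  apply: cproj_ext => [||i k s] /=; try by rewrite (compa1 PD) (comp1a PD).
  apply: eqo_of_tot; rewrite !tot_comp !tcompA cproj_prod_cell.
  rewrite cproj_prod_laxator -[RHS]tcompA cproj_prod_laxator.
  rewrite -!tot_comp -!(interchange PD).
  by apply: hcomp_tot; rewrite !tot_comp cproj_prod_cell.
- move=> X Y F; apply: cproj_ext => [||i j e] /=;
    try by rewrite (compa1 PD) (comp1a PD).
  destruct e.
  have C := @cproj_prod_cell X X Y Y (fam_idp X) (fam_idp Y) F F (fam_idpc F) i i erefl.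
  apply: eqo_of_tot; rewrite !tot_comp !tcompA C.
  rewrite cproj_prod_unitor -[RHS]tcompA cproj_prod_unitor.
  rewrite -!tot_comp -!(idpc_comp PD); congr (tot (idpc _)).
  exact: proj_prod_arr.
- move=> X Y Z W M N R; apply: cproj_ext => [||i l [j [a [k [b c]]]]];
    try by rewrite /= prod_arr_id !(compa1 PD).
  have E1 : (cproj (M := fam_compp M N) (existT _ j (a, b)) ⊛ cproj c)
      ∙ (prod_laxator M N ⊛ idc (prod_pro Q R))
      ≡ (cproj a ⊛ cproj b) ⊛ cproj c.
    rewrite -(interchange PD); apply: hcomp_congr; last exact: (compc1 PD).
    apply: eqo_of_tot; exact: (cproj_prod_laxator (M := M) (N := N)).
  have E2 : (cproj a ⊛ cproj (M := fam_compp N R) (existT _ k (b, c)))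
      ∙ (idc (prod_pro Q M) ⊛ prod_laxator N R)
      ≡ cproj a ⊛ (cproj b ⊛ cproj c).
    rewrite -(interchange PD); apply: hcomp_congr; first exact: (compc1 PD).
    apply: eqo_of_tot; exact: (cproj_prod_laxator (M := N) (N := R)).
  move/totP: E1 => E1; move/totP: E2 => E2; rewrite !tot_comp in E1 E2.
  apply: eqo_of_tot; rewrite !tot_comp !tcompA cproj_prod_cell.
  rewrite cproj_prod_laxator E2 -tcompA -tcompA [X in tcomp _ X]tcompA.
  rewrite cproj_prod_laxator E1.
  exact: totP (assoc_nat PD (cproj a) (cproj b) (cproj c)).
- move=> X Y M; apply: cproj_ext => [||i j s];
    try by rewrite /= prod_arr_id !(compa1 PD).
  have E1 : (cproj (M := fam_idp X) (erefl i) ⊛ cproj s)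
      ∙ (prod_unitor X ⊛ idc (prod_pro Q M)) ≡ idpc (proj Q X i) ⊛ cproj s.
    rewrite -(interchange PD); apply: hcomp_congr; last exact: (compc1 PD).
    apply: eqo_of_tot; exact: cproj_prod_unitor.
  move/totP: E1 => E1; rewrite !tot_comp in E1.
  apply: eqo_of_tot; rewrite !tot_comp !tcompA cproj_prod_cell.
  rewrite -[X in tcomp X _]tcompA cproj_prod_laxator -tcompA E1.
  exact: totP (lunit_nat PD (cproj s)).
- move=> X Y M; apply: cproj_ext => [||i j s];
    try by rewrite /= prod_arr_id !(compa1 PD).
  have E1 : (cproj s ⊛ cproj (M := fam_idp Y) (erefl j))
      ∙ (idc (prod_pro Q M) ⊛ prod_unitor Y) ≡ cproj s ⊛ idpc (proj Q Y j).
    rewrite -(interchange PD); apply: hcomp_congr; first exact: (compc1 PD).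
    apply: eqo_of_tot; exact: cproj_prod_unitor.
  move/totP: E1 => E1; rewrite !tot_comp in E1.
  apply: eqo_of_tot; rewrite !tot_comp !tcompA cproj_prod_cell.
  rewrite -[X in tcomp X _]tcompA cproj_prod_laxator -tcompA E1.
  exact: totP (runit_nat PD (cproj s)).
Qed.

Definition prod_functor : lax_functor (FinFam D) D := LaxFunctor prod_laws.

Definition unit_ob (w : D) : arr w (prod_ob Q (fam1 w)) :=
  tuple (X := fam1 w) (fun _ => ida w).

Lemma proj_unit_ob (w : D) i : proj Q (fam1 w) i ∘ unit_ob w = ida w.
Proof. exact: proj_tuple. Qed.

Definition unit_pro (x y : D) (m : pro x y) :
    cell m (prod_pro Q (fam1_pro m)) (unit_ob x) (unit_ob y) :=
  @lift (fam1 x) (fam1 y) (fam1_pro m) _ _ _ _ _ _ _ (fun _ _ _ => idc m)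
    (@proj_unit_ob x) (@proj_unit_ob y).

Lemma cproj_unit_pro (x y : D) (m : pro x y) i j s :
  tcomp (tot (@cproj (fam1 x) (fam1 y) (fam1_pro m) i j s)) (tot (unit_pro m))
    = tot (idc m).
Proof.
exact: totP
  (@cproj_lift (fam1 x) (fam1 y) (fam1_pro m) _ _ _ _ _ _ _ _ _ _ _ _ _).
Qed.

Lemma unit_ob_nat (x y : D) (f : arr x y) :
  unit_ob y ∘ f = prod_arr (fam1_arr f) ∘ unit_ob x.
Proof.
apply: proj_ext => i.
rewrite (compaA PD) proj_unit_ob (comp1a PD) (compaA PD) proj_prod_arr.
by rewrite -(compaA PD) proj_unit_ob (compa1 PD).
Qed.

Definition prod_unit : nat_trans (lax_id D) (lax_comp prod_functor (Delta D)).
Proof.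
exists unit_ob unit_pro.
- exact: unit_ob_nat.
- move=> x y w z m n f g a; apply: cproj_ext => [||i j s]; try exact: unit_ob_nat.
  apply: eqo_of_tot; rewrite !tot_comp !tcompA cproj_unit_pro tcomp1c.
  by rewrite cproj_prod_cell -tcompA cproj_unit_pro (tcompc1 (tot a)).
- move=> x y z m n.
  apply: eqo_trans _ (compc_congr (eqo_sym (cast_overE _ _ _)) (eq_over_refl _)).
  apply: cproj_ext => [||i j s];
    try by rewrite /= (compa1 PD) prod_arr_id !(comp1a PD).
  apply: eqo_of_tot; rewrite !tot_comp !tcompA cproj_unit_pro tcomp1c.
  rewrite cproj_prod_cell -[X in tcomp X _]tcompA cproj_prod_laxator tcomp1c.
  rewrite -tot_comp -(interchange PD).
  transitivity (tot (idc m ⊛ idc n)); first by rewrite (hcomp_id PD).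
  by apply: hcomp_tot; rewrite tot_comp cproj_unit_pro.
- move=> x.
  apply: eqo_trans _ (compc_congr (eqo_sym (cast_overE _ _ _)) (eq_over_refl _)).
  apply: cproj_ext => [||i j s];
    try by rewrite /= (compa1 PD) prod_arr_id !(comp1a PD).
  case: i j s => -[] [].
  apply: eqo_of_tot; rewrite !tot_comp !tcompA cproj_unit_pro tcomp1c.
  rewrite cproj_prod_cell -[X in tcomp X _]tcompA cproj_prod_unitor tcomp1c.
  by rewrite -tot_comp -(idpc_comp PD) proj_unit_ob (idpc_id PD).
Defined.

Definition counit_arr (X : fam D) : fam_arr (fam1 (prod_ob Q X)) X :=
  @FamArr _ (fam1 (prod_ob Q X)) X (fun _ => tt) (proj Q X).

Definition counit_cell (X Y : fam D) (M : fam_pro X Y) :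
    fam_cell (fam1_pro (prod_pro Q M)) M (counit_arr X) (counit_arr Y) :=
  @FamCell _ _ _ _ _ (fam1_pro (prod_pro Q M)) M (counit_arr X) (counit_arr Y)
    (fun _ _ _ => tt) (fun i j s => cproj s).

Definition prod_counit : nat_trans (lax_comp (Delta D) prod_functor) (lax_id (FinFam D)).
Proof.
exists counit_arr counit_cell.
- by move=> X Y F; apply: fam_arr_eq => j; exact: proj_prod_arr.
- move=> X Y W Z M N F G c; apply: fam_eqo => [j|j|k l b];
    try exact: proj_prod_arr.
  by congr existT; exact: cproj_prod_cell.
- move=> X Y Z M N.
  apply: eqo_trans (compc_congr (eq_over_refl _) (cast_overE _ _ _)) _.
  apply: fam_eqo => [j|j|i k s]; try by rewrite /= !(compa1 PD) !(comp1a PD).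
  congr existT; rewrite !tot_comp tcompc1 tcomp1c.
  exact: cproj_prod_laxator.
- move=> X.
  apply: eqo_trans (compc_congr (eq_over_refl _) (cast_overE _ _ _)) _.
  apply: fam_eqo => [j|j|i k e]; try by rewrite /= !(compa1 PD) !(comp1a PD).
  destruct e; congr existT; rewrite !tot_comp tcompc1 tcomp1c.
  exact: cproj_prod_unitor.
Defined.

(** Two arrows between singleton families have reindexing maps [unit -> unit]
    which are equal without being convertible, as the one of [counit_arr] is
    constant; hence this and the next lemma for the triangle identities. *)
Lemma fam1_arr_eq (x y : D) (F G : fam_arr (fam1 x) (fam1 y)) :
  farr F tt = farr G tt -> F = G.
Proof.
case: F G => [F f] [G g] /=.
have e : F = G by apply: functional_extensionality => j; case: (F j) (G j) => [] [].
by subst G => e; congr FamArr; apply: functional_extensionality_dep => -[].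
Qed.

Lemma fam1_eqo (x y w z : D) (m : pro x y) (n : pro w z)
    (F F' : fam_arr (fam1 x) (fam1 w)) (G G' : fam_arr (fam1 y) (fam1 z))
    (c : fam_cell (fam1_pro m) (fam1_pro n) F G)
    (c' : fam_cell (fam1_pro m) (fam1_pro n) F' G') :
  @fcell _ _ _ _ _ _ _ _ _ c tt tt tt ≡ @fcell _ _ _ _ _ _ _ _ _ c' tt tt tt ->
  @eq_over _ _ (@cell (fam_data D) _ _ _ _ (fam1_pro m) (fam1_pro n)) _ _ c _ _ c'.
Proof.
move=> E; have [eF eG] := eqo_sides E.
move/fam1_arr_eq: eF => eF; move/fam1_arr_eq: eG => eG; subst F' G'.
case: F G c c' E => [F f] [G g] c c' E; apply: fam_eqo => // -[] [] [].
move: (fsmap c _) (fcell c _) (fsmap c' _) (fcell c' _) E => [] a [] a' E.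
by congr existT; apply: totP.
Qed.

Lemma prod_triangle (X : fam D) :
  prod_arr (counit_arr X) ∘ unit_ob (prod_ob Q X) = ida (prod_ob Q X).
Proof.
apply: proj_ext => i; rewrite (compaA PD) proj_prod_arr.
by rewrite -(compaA PD) proj_unit_ob.
Qed.

Definition prod_adjoint : lax_right_adjoint (Delta D).
Proof.
exists prod_functor prod_unit prod_counit.
- by move=> x; apply: fam1_arr_eq; exact: proj_unit_ob.
- by move=> x y m; apply: fam1_eqo; apply: eqo_of_tot; exact: cproj_unit_pro.
- exact: prod_triangle.
- move=> X Y M; apply: cproj_ext => [||i j s]; try exact: prod_triangle.
  apply: eqo_of_tot; rewrite !tot_comp !tcompA cproj_prod_cell.
  by rewrite -tcompA cproj_unit_pro (tcompc1 (tot (cproj s))).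
Defined.

End Products.

(** * Products of families from parallel products *)

(** The fibre of the left leg over [i] is the type [{j & A i j}].  Stated on
    these fibres, bijectivity provides elements of the span with prescribed
    left end by conversion, as the types of proarrows require. *)
Lemma left_leg_section (I J : finType) (A : span I J) :
  bijective (left_leg A) ->
  exists t : forall i, {j & A i j}, forall i j (a : A i j), t i = existT _ j a.
Proof.
move=> [g gK Kg].
exists (fun i => match Kg i in _ = i' return {j & A i' j} with
  erefl => existT _ (tag (g i)).2 (tagged (g i)) end) => i j a.
have E := gK (existT (fun ij : I * J => A ij.1 ij.2) (i, j) a).
move: (Kg i); rewrite /left_leg /= in E *; rewrite E /= => e.
by rewrite (proof_irrelevance _ e erefl).
Qed.

Lemma right_leg_section (I J : finType) (A : span I J) :
  bijective (right_leg A) ->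
  exists t : forall j, {i & A i j}, forall i j (a : A i j), t j = existT _ i a.
Proof.
move=> [g gK Kg].
exists (fun j => match Kg j in _ = j' return {i & A i j'} with
  erefl => existT _ (tag (g j)).1 (tagged (g j)) end) => i j a.
have E := gK (existT (fun ij : I * J => A ij.1 ij.2) (i, j) a).
move: (Kg j); rewrite /right_leg /= in E *; rewrite E /= => e.
by rewrite (proof_irrelevance _ e erefl).
Qed.

Section ProductsOfParallel.
Variable D : double_category.
Hypothesis eqD : is_equipment D.
Variable PP : forall I : finType, lax_right_adjoint (diag D I).
Let PD := dblP D.

Definition pprod (I : finType) (x : I -> D) : D := PP I x.
Definition pproj (I : finType) (x : I -> D) i : arr (pprod x) (x i) :=
  parallel_proj (PP I) x i.

Lemma pprodP (I : finType) (x : I -> D) (w : D) (f : forall i, arr w (x i)) :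
  exists! h : arr w (pprod x), forall i, pproj x i ∘ h = f i.
Proof. exact: parallel_product. Qed.

Lemma pprod_ext (I : finType) (x : I -> D) (w : D) (h k : arr w (pprod x)) :
  (forall i, pproj x i ∘ h = pproj x i ∘ k) -> h = k.
Proof.
move=> E; have [h0 [_ U]] := pprodP (fun i => pproj x i ∘ h).
by rewrite -(U h) // -(U k).
Qed.

Lemma prod_pro_exists (X Y : fam D) (M : fam_pro X Y) :
  exists Rc : {R : pro (pprod X) (pprod Y) &
      forall s : apex (fspan M),
        cell R (fpro (tagged s)) (pproj X (tag s).1) (pproj Y (tag s).2)},
    jointly_cartesian (projT2 Rc).
Proof.
pose A := apex (fspan M).
have [h [Hh _]] := pprodP (fun s : A => pproj X (tag s).1).
have [k [Hk _]] := pprodP (fun s : A => pproj Y (tag s).2).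
pose m (s : A) := fpro (tagged s).
have [R [r Hr]] := eqD (Fpro (PP A) (m : @pro (pow D A) _ _)) h k.
exists (existT _ R (fun s => cast_over (Hh s) (Hk s)
  (parallel_cproj (PP A) m s ∙ r))).
have Cm := parallel_product_pro (PP A) (m : @pro (pow D A) _ _).
refine (jc_comp _ Cm Hr) => s.
exact: eqo_sym (cast_overE _ _ _).
Qed.

Definition parallel_products : products D := {|
  prod_ob := fun X : fam D => pprod X;
  proj := fun X i => pproj X i;
  projP := fun X w f => pprodP f;
  prod_pro := fun X Y M =>
    projT1 (proj1_sig (constructive_indefinite_description _ (prod_pro_exists M)));
  apex_cproj := fun X Y M =>
    projT2 (proj1_sig (constructive_indefinite_description _ (prod_pro_exists M)));
  apex_cprojP := fun X Y M =>
    proj2_sig (constructive_indefinite_description _ (prod_pro_exists M)) |}.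

Let Q := parallel_products.

Hypothesis pseudoPP : forall I, is_pseudo (PP I).

(** [idp] of a product is isomorphic to the parallel product of the
    [idp (X i)], so the cells [idpc] of the projections are jointly
    cartesian; the identity span has its apex in bijection with the indexing
    set. *)
Lemma unitor_iso (X : fam D) : iso_cell (prod_unitor Q X).
Proof.
apply: restriction_iso.
have C1 : jointly_cartesian (fun i => idpc (pproj X i)).
  have Cp := parallel_product_pro (PP (fidx X)) (idp (X : pow D (fidx X))).
  refine (jc_comp _ Cp (r := unitor (PP (fidx X)) (X : pow D (fidx X))) _).
    by move=> i; exact: parallel_unitor.
  by apply: iso_restriction; case: (pseudoPP (fidx X)).
pose c (s : apex (id_span (fidx X))) :=
  match tagged s as e' in _ = j' return
      cell (idp (pprod X)) (@fpro _ _ _ (fam_idp X) _ _ e')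
        (pproj X (tag s).1) (pproj X j') with
    erefl => idpc (pproj X (tag s).1) end.
have C2 : jointly_cartesian c.
  pose sigma i : apex (id_span (fidx X)) :=
    existT (fun ij => id_span (fidx X) ij.1 ij.2) (i, i) erefl.
  apply: (jc_reindex (sigma := sigma)) C1 => -[[i j] e].
  by exists i; simpl in e; destruct e.
apply: jc_cancel _ (apex_cprojP Q (fam_idp X)) C2 => -[[i j] /= e].
destruct e; apply: eqo_of_tot; exact: (cproj_prod_unitor Q (X := X)).
Qed.

(** The apex [C] of the composite span indexes the factors of both [M] and [N]:
    since the legs into [fidx Y] are bijective, so are the projections of [C]
    to the apices of [M] and [N] and to [fidx Y].  For [c] in [C], the factors
    [m c] and [n c] are composable by conversion, which would fail were they
    indexed by the separate apices. *)
Section Laxator.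
Variables (X Y Z : fam D) (M : fam_pro X Y) (N : fam_pro Y Z).
Hypothesis bijM : bijective (right_leg (fspan M)).
Hypothesis bijN : bijective (left_leg (fspan N)).

Let C := apex (fspan (fam_compp M N)).
Let x (s : C) := X (tag s).1.
Let y (s : C) := Y (tag (tagged s)).
Let z (s : C) := Z (tag s).2.
Let m (s : C) : pro (x s) (y s) := fpro (tagged (tagged s)).1.
Let n (s : C) : pro (y s) (z s) := fpro (tagged (tagged s)).2.
Let point i j k (a : fspan M i j) (b : fspan N j k) : C :=
  existT (fun ij => fspan (fam_compp M N) ij.1 ij.2) (i, k) (existT _ j (a, b)).

Lemma laxator_iso : iso_cell (prod_laxator Q M N).
Proof.
have [ta Ha] := right_leg_section bijM.
have [tb Hb] := left_leg_section bijN.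
have [f [Hf _]] := pprodP (fun s : C => pproj X (tag s).1).
have [u [Hu _]] := pprodP (fun s : C => pproj Y (tag (tagged s))).
have [g [Hg _]] := pprodP (fun s : C => pproj Z (tag s).2).
(* [C] is in bijection with [fidx Y] by its middle leg, whose inverse sends
   [j] to the point with the unique elements of [M] and [N] over [j]. *)
have [u' [Hu' _]] := pprodP (fun j =>
  pproj y (point (projT2 (ta j)) (projT2 (tb j)))).
have uu' : u ∘ u' = ida _.
  apply: pprod_ext => -[[i k] [j [a b]]].
  rewrite (compaA PD) Hu Hu' (compa1 PD).
  by rewrite (Ha _ _ a) (Hb _ _ b).
have u'u : u' ∘ u = ida _.
  apply: pprod_ext => j; rewrite (compaA PD) Hu' Hu (compa1 PD).
  by [].
(* [sigma] completes an element of one span by the unique element of the other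
   over the same [j].  The reindexed projections agree with the original ones
   only after splitting pairs, hence the last lines of each case. *)
have CM : jointly_cartesian (fun s : C => cproj Q (tagged (tagged s)).1).
  pose sigma (s : apex (fspan M)) : C := point (tagged s) (projT2 (tb (tag s).2)).
  apply: (jc_reindex (sigma := sigma)) => [[[i k] [j [a b]]]|].
    exists (existT (fun ij => fspan M ij.1 ij.2) (i, j) a).
    by rewrite /sigma /= (Hb _ _ b).
  move=> v w l h h' b.
  have [d [Hd U]] := apex_cprojP Q M _ _ l h h' b.
  exists d; split=> [[[i j] a]|d' Hd']; first exact: (Hd (existT _ (i, j) a)).
  by apply: U => -[[i j] a]; exact: (Hd' (existT _ (i, j) a)).
have CN : jointly_cartesian (fun s : C => cproj Q (tagged (tagged s)).2).
  pose sigma (s : apex (fspan N)) : C := point (projT2 (ta (tag s).1)) (tagged s).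
  apply: (jc_reindex (sigma := sigma)) => [[[i k] [j [a b]]]|].
    exists (existT (fun ij => fspan N ij.1 ij.2) (j, k) b).
    by rewrite /sigma /= (Ha _ _ a).
  move=> v w l h h' b.
  have [d [Hd U]] := apex_cprojP Q N _ _ l h h' b.
  exists d; split=> [[[i j] a]|d' Hd']; first exact: (Hd (existT _ (i, j) a)).
  by apply: U => -[[i j] a]; exact: (Hd' (existT _ (i, j) a)).
(* By cancellation [kM] and [kN] are restrictions, over [f] and [u] and over
   [u] and [g]. *)
have [||kM HM] := jc_lift (parallel_product_pro (PP C) m) (h := f) (k := u)
  (fun s => cproj Q (tagged (tagged s)).1); try by [].
have [||kN HN] := jc_lift (parallel_product_pro (PP C) n) (h := u) (k := g)
  (fun s => cproj Q (tagged (tagged s)).2); try by [].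
have RM := jc_cancel HM (parallel_product_pro (PP C) m) CM.
have RN := jc_cancel HN (parallel_product_pro (PP C) n) CN.
have RMN := hcomp_restriction eqD uu' u'u RM RN.
have C1 : jointly_cartesian
    (fun s : C => parallel_cproj (PP C) m s ⊛ parallel_cproj (PP C) n s).
  have Cp := parallel_product_pro (PP C)
    ((m : @pro (pow D C) _ _) ⊙ (n : @pro (pow D C) _ _)).
  refine (jc_comp _ Cp (r := @laxator _ _ (PP C) (x : pow D C) y z m n) _).
    by move=> s; exact: parallel_laxator.
  by apply: iso_restriction; case: (pseudoPP C).
have C2 : jointly_cartesian (fun s : C =>
    cproj Q (tagged (tagged s)).1 ⊛ cproj Q (tagged (tagged s)).2).
  apply: jc_comp _ C1 RMN => s; rewrite -(interchange PD).
  exact: hcomp_congr (HM s) (HN s).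
apply/restriction_iso; apply: jc_cancel _ (apex_cprojP Q (fam_compp M N)) C2.
move=> -[[i k] s]; apply: eqo_of_tot.
exact: (cproj_prod_laxator Q (M := M) (N := N)).
Qed.

End Laxator.
End ProductsOfParallel.

Theorem corollary8p7 (D : double_category) :
  (precartesian_equipment D -> has_lax_finite_products D) /\
  (cartesian_equipment D -> has_iso_strong_finite_products D).
Proof.
split=> -[eqD cD].
  have PP (I : finType) : lax_right_adjoint (diag D I).
    have : exists P : lax_right_adjoint (diag D I), True.
      by case: (cD I) => P; exists P.
    by move/constructive_indefinite_description => [].
  exact: (inhabits (prod_adjoint (parallel_products eqD PP))).
pose PP (I : finType) := proj1_sig (constructive_indefinite_description _ (cD I)).
have pPP (I : finType) : is_pseudo (PP I) :=
  proj2_sig (constructive_indefinite_description _ (cD I)).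
exists (prod_adjoint (parallel_products eqD PP)); split.
  exact: unitor_iso.
by move=> X Y Z M N bM bN; exact: laxator_iso.
Qed.
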